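(* Let $d\ge 2$ and let $K:\mathbb{S}^{d-1}\times\mathbb{S}^{d-1}\to\mathbb{C}$ be a kernel of the form $$K(\xi,\zeta)=\sum_{L\in I_d}\ \sum_{L'\in I_d} a_{L,L'}\,Y_{L}(\xi)\,\overline{Y_{L'}(\zeta)},\qquad \xi,\zeta\in\mathbb{S}^{d-1},$$ with coefficients $a_{L,L'}=a_{\ell_1,\ldots,\ell_{d-1},\ell_1',\ldots,\ell_{d-1}'}\in\mathbb{C}$ satisfying $$\sum_{L,L'\in I_d}|a_{L,L'}|\,\frac{\sqrt{N_{\deg L,d}\,N_{\deg L',d}}}{\sigma_{d-1}}<\infty .$$ Then $K$ is axially symmetric with respect to the $\theta_1$ axis if and only if there are functions $c_{\ell_1}$ ($\ell_1\in\mathbb{Z}$) such that for all $L=(\ell_1,\ldots,\ell_{d-1})$, $L'=(\ell_1',\ldots,\ell'_{d-1})$ in $I_d$, $$a_{\ell_1,\ldots,\ell_{d-1},\ell_1',\ldots,\ell_{d-1}'}=\delta_{\ell_1,\ell_1'}\,c_{\ell_1}(\ell_2,\ldots,\ell_{d-1},\ell_2',\ldots,\ell_{d-1}').$$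
   Context: $\mathbb{S}^{d-1}$ is the unit sphere in $\mathbb{R}^d$ and $\sigma_{d-1}$ its surface area. $N_{0,d}=1$ and $N_{j,d}=\frac{(2j+d-2)(j+d-3)!}{j!(d-2)!}$ for $j\ge1$ (the dimension of the space of spherical harmonics of degree $j$). Polar coordinates: $\xi\in\mathbb{S}^{d-1}$ is described by $(\theta_1,\ldots,\theta_{d-1})$, $\theta_1\in[0,2\pi)$, $\theta_2,\ldots,\theta_{d-1}\in[0,\pi]$, with $\xi_d=\cos\theta_{d-1}$, $\xi_{d-1}=\sin\theta_{d-1}\cos\theta_{d-2}$, ..., $\xi_2=\sin\theta_{d-1}\cdots\sin\theta_2\sin\theta_1$, $\xi_1=\sin\theta_{d-1}\cdots\sin\theta_2\cos\theta_1$. Index set: $I_d=\{(\ell_1,\ldots,\ell_{d-1})\in\mathbb{Z}^{d-1}: |\ell_1|\le\ell_2\le\cdots\le\ell_{d-1}\}$ (so $I_2=\mathbb{Z}$). The degree of $L=(\ell_1,\ldots,\ell_{d-1})$ is $\deg L=\ell_{d-1}$ if $d\ge3$ and $\deg L=|\ell_1|$ if $d=2$. Basis: the orthonormal basis of $L^2(\mathbb{S}^{d-1})$ of spherical harmonics $$Y_{\ell_1,\ldots,\ell_{d-1}}(\theta_1,\ldots,\theta_{d-1})=\frac{1}{\sqrt{2\pi}}e^{i\ell_1\theta_1}\prod_{j=2}^{d-1}{}_{j}\tilde P_{\ell_j}^{\ell_{j-1}}(\theta_j),$$ where ${}_{j}\tilde P_{L}^{\ell}(\theta)={}_{j}c_L^{\ell}\,(\sin\theta)^{(2-j)/2}P_{L+(j-2)/2}^{-(\ell+(j-2)/2)}(\cos\theta)$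 (extended continuously to $\theta\in\{0,\pi\}$), $P_\nu^\mu$ are the associated Legendre functions on $(-1,1)$, and ${}_{j}c_L^{\ell}=\left(\frac{2L+j-1}{2}\frac{(L+\ell+j-2)!}{(L-\ell)!}\right)^{1/2}$. Axial symmetry: $K$ is axially symmetric with respect to the $\theta_1$ axis if $K(R_\alpha\xi,R_\alpha\zeta)=K(\xi,\zeta)$ for all $\xi,\zeta\in\mathbb{S}^{d-1}$ and all $\alpha$, where $R_\alpha$ is the rotation $\theta_1\mapsto\theta_1+\alpha$ leaving $\theta_2,\ldots,\theta_{d-1}$ fixed. *)

(* Defs.v *)
From mathcomp Require Import all_boot all_order all_algebra.
From mathcomp Require Import finmap.
From mathcomp Require Import all_classical all_reals all_analysis.
From mathcomp Require summability.
From mathcomp Require Import complex.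
Set Implicit Arguments.
Unset Strict Implicit.
Unset Printing Implicit Defensive.
Import Order.TTheory GRing.Theory Num.Theory numFieldNormedType.Exports.
Local Open Scope classical_set_scope.
Local Open Scope ring_scope.
Local Open Scope complex_scope.

(* Angles (theta_1, ..., theta_{d-1}) and multi-indices (l_1, ..., l_{d-1})
   are (d.-1)-tuples; [entry s j] is the entry with 1-based number j. *)
Definition entry (T : nmodType) (s : seq T) (j : nat) : T := nth 0 s j.-1.

Definition cmod (R : realType) (z : R[i]) : R := ComplexField.Normc.normc z.

Section SpecialFunctions.
Variable R : realType.
Implicit Types a b c x z nu mu : R.

(* The entire function 1 / Gamma, by Gauss's product
   1 / Gamma(x) = lim_n x (x + 1) ... (x + n) / (n! n^x);
   it vanishes at the poles 0, -1, -2, ... of Gamma. *)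
Definition rgamma x : R :=
  lim ((\prod_(i < n.+1) (x + i%:R)) / (n`!%:R * n%:R `^ x) @[n --> \oo]).

Definition pochhammer a (n : nat) : R := \prod_(i < n) (a + i%:R).

(* Regularized Gauss function 2F1(a, b; c; z) / Gamma(c), for |z| < 1; the
   regularization makes sense of the case c = 0, -1, -2, ... *)
Definition hyp2F1reg a b c z : R :=
  limn (series (fun n =>
    pochhammer a n * pochhammer b n * rgamma (c + n%:R) / n`!%:R * z ^+ n)).

(* Associated Legendre function of the first kind P_nu^mu on the cut (-1, 1)
   (Ferrers function), for arbitrary real degree nu and order mu. *)
Definition legendreP nu mu x : R :=
  ((1 + x) / (1 - x)) `^ (mu / 2) *
  hyp2F1reg (nu + 1) (- nu) (1 - mu) ((1 - x) / 2).

(* |l| <= L for the indices of interest, so that the arguments of the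
   factorials are nonnegative and absz is the identity on them. *)
Definition legendre_coef (j : nat) (L l : int) : R :=
  Num.sqrt (((2 * L%:~R + j%:R - 1) / 2) *
            ((absz (L + l + j%:Z - 2)%R)`!%:R / (absz (L - l)%R)`!%:R)).

Definition legendre_tilde_int (j : nat) (L l : int) (theta : R) : R :=
  legendre_coef j L l * sin theta `^ ((2 - j%:R) / 2) *
  legendreP (L%:~R + (j%:R - 2) / 2) (- (l%:~R + (j%:R - 2) / 2)) (cos theta).

Definition legendre_tilde (j : nat) (L l : int) (theta : R) : R :=
  if 0 < theta < pi then legendre_tilde_int j L l theta
  else if theta <= 0 then lim (legendre_tilde_int j L l t @[t --> 0^'+])
  else lim (legendre_tilde_int j L l t @[t --> pi^'-]).

End SpecialFunctions.

Section Sphere.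
Variables (R : realType) (d : nat).

Definition unit_sphere : set 'rV[R]_d := [set x | \sum_i x 0 i ^+ 2 = 1].

(* Surface area of the unit sphere of R^d: 2 pi^(d/2) / Gamma(d/2). *)
Definition sphere_area : R := 2 * pi `^ (d%:R / 2) * rgamma (d%:R / 2).

Definition dim_harmonics (j : nat) : R :=
  if j == 0%N then 1
  else ((2 * j + d - 2) * (j + d - 3)`!)%:R / (j`! * (d - 2)`!)%:R.

(* The coordinate xi_k of the text is the entry number k.-1 of the vector. *)
Definition polar (theta : (d.-1).-tuple R) : 'rV[R]_d :=
  \row_(i < d)
    match nat_of_ord i with
    | 0 => (\prod_(2 <= m < d) sin (entry theta m)) * cos (entry theta 1)
    | 1 => (\prod_(2 <= m < d) sin (entry theta m)) * sin (entry theta 1)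
    | k => (\prod_(k.+1 <= m < d) sin (entry theta m)) * cos (entry theta k)
    end.

Definition angle_domain : set ((d.-1).-tuple R) :=
  [set theta | 0 <= entry theta 1 < 2 * pi /\
     forall j, (2 <= j < d)%N -> 0 <= entry theta j <= pi].

(* Polar coordinates of a point. Where they are not unique (some sin theta_j
   vanishes) one choice is made; the harmonics below do not depend on it. *)
Definition angles (x : 'rV[R]_d) : (d.-1).-tuple R :=
  xget [tuple of nseq d.-1 0]
       [set theta | angle_domain theta /\ polar theta = x].

(* The rotation by alpha in the plane of the first two coordinates, acting on
   row vectors by right multiplication; see polar_rotation. *)
Definition rotation (alpha : R) : 'M[R]_d :=
  \matrix_(i, j)
    match nat_of_ord i, nat_of_ord j with
    | 0, 0 => cos alpha
    | 0, 1 => sin alpha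
    | 1, 0 => - sin alpha
    | 1, 1 => cos alpha
    | k, m => (k == m)%:R
    end.

Definition axially_symmetric (K : 'rV[R]_d -> 'rV[R]_d -> R[i]) : Prop :=
  forall xi zeta alpha, unit_sphere xi -> unit_sphere zeta ->
    K (xi *m rotation alpha) (zeta *m rotation alpha) = K xi zeta.

End Sphere.

(* |l_1| <= l_2 <= ... <= l_{d-1} *)
Definition in_Iset (d : nat) (L : (d.-1).-tuple int) : bool :=
  path <=%R `|entry L 1| (behead L).

Definition Iset (d : nat) := {L : (d.-1).-tuple int | in_Iset L}.

(* l_{d-1} is nonnegative if d >= 3, so that this is l_{d-1} if d >= 3, and
   |l_1| if d = 2. *)
Definition deg (d : nat) (L : Iset d) : nat := absz (entry (val L) d.-1).

Section Harmonics.
Variables (R : realType) (d : nat).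

Definition expi (t : R) : R[i] := cos t +i* sin t.

Definition sph_harmonic_polar (L : Iset d) (theta : (d.-1).-tuple R) : R[i] :=
  (Num.sqrt (2 * pi))^-1%:C *
  expi ((entry (val L) 1)%:~R * entry theta 1) *
  \prod_(2 <= j < d)
    (legendre_tilde j (entry (val L) j) (entry (val L) j.-1)
                      (entry theta j))%:C.

Definition sph_harmonic (L : Iset d) (x : 'rV[R]_d) : R[i] :=
  sph_harmonic_polar L (angles x).

End Harmonics.

(* Unconditional convergence of a family of complex numbers: the sums over
   finite subsets, ordered by inclusion, tend to s. *)
Definition has_sum (R : realType) (I : choiceType) (f : I -> R[i]) (s : R[i])
  : Prop :=
  cmod (summability.partial_sum f J - s) @[J --> summability.totally]
    --> (0 : R).

Lemma polar_rotation (R : realType) (d : nat) (theta theta' : (d.-1).-tuple R)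
    (alpha : R) : (2 <= d)%N ->
  entry theta' 1 = entry theta 1 + alpha ->
  (forall j, (2 <= j < d)%N -> entry theta' j = entry theta j) ->
  polar theta' = polar theta *m rotation d alpha.
Proof.
case: d theta theta' => [|[|d]] // theta theta' _ E1 Ej.
have Epr k : (2 <= k)%N -> \prod_(k <= m < d.+2) sin (entry theta' m) =
    \prod_(k <= m < d.+2) sin (entry theta m).
  move=> k2; apply: eq_big_nat => m /andP[km md].
  by rewrite Ej // (leq_trans k2 km).
apply/rowP => i; rewrite !mxE big_ord_recl big_ord_recl !mxE /=.
rewrite /bump /= -[1%N]/(1%N).
case: i => [[|[|k]] ik] /=.
- rewrite [X in _ + (_ + X)]big1 => [|j _]; last by rewrite !mxE /= mulr0.
  by rewrite Epr // E1 cosD addr0 mulrN mulrBr !mulrA.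
- rewrite [X in _ + (_ + X)]big1 => [|j _]; last by rewrite !mxE /= mulr0.
  by rewrite Epr // E1 sinD addr0 mulrDr !mulrA addrC.
- have kd : (k < d)%N by [].
  rewrite !mulr0 !add0r (bigD1 (Ordinal kd)) //= [X in _ + X]big1 => [|j jk].
    by rewrite !mxE /= eqxx mulr1 addr0 Epr // Ej.
  rewrite !mxE /= add0n.
  have -> : (j.+2 == k.+2) = false.
    by apply/negbTE; apply: contraNneq jk => -[jk]; apply/eqP/val_inj.
  by rewrite mulr0.
Qed.

(* Main.v *)
(** Rotating both arguments by alpha multiplies the coefficient a_{L,L'} by
    exp(i (l_1 - l_1') alpha), so everything rests on the uniqueness of the
    coefficients of an absolutely convergent double expansion in spherical
    harmonics. Instead of a sup norm bound (the addition theorem), uniqueness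
    only uses the L2 normalisation of the basis: the angles are integrated out
    one at a time against the factors of a fixed pair of harmonics, with
    dominated convergence at each step, and for a pair (L, L') different from
    the fixed one the factor at the first differing index vanishes by
    orthogonality. The Legendre factors are reduced to sin^l times a Jacobi
    polynomial in z = (1 - cos theta)/2 by Euler's transformation of the
    hypergeometric function, and orthogonality and norms follow from
    Rodrigues' recurrence by integration by parts. *)
Require Import Defs.
From mathcomp Require Import all_boot all_order all_algebra.
From mathcomp Require Import all_classical all_reals all_analysis.
From mathcomp Require Import complex.
From mathcomp Require Import zify ring lra.
From mathcomp Require Import finmap.
From mathcomp Require summability.
Import Order.TTheory GRing.Theory Num.Theory numFieldNormedType.Exports.
Local Open Scope classical_set_scope.
Local Open Scope ring_scope.
Local Open Scope complex_scope.
Set Implicit Arguments.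
Unset Strict Implicit.
Unset Printing Implicit Defensive.

(** In the factor of index j the Legendre function has degree L + (j-2)/2 and order -(l + (j-2)/2),
    both in (1/2)Z, and L - l is a natural number. So 1/Gamma is evaluated only at half-integers.
    There positivity and the functional equation suffice; the price is that the norms of the
    Legendre factors are known up to constants [kappa], which are positive and bounded. Only l_1 can
    be negative, and it is the order of the factor j = 2: there the third hypergeometric parameter
    falls on a pole of Gamma, and the series has to be treated apart. Without a sup norm bound, the
    dominating function for the termwise integration is the series of absolute values itself, finite
    only for almost every angle. The induction over the angles is therefore stated for an arbitrary
    absolutely summable sequence of coefficients, so that factors at angles already fixed can be
    absorbed into it, and it asks for a uniform bound of the integral of each single factor. The
    dimensions N are at least 1, so the weighted hypothesis yields absolute summability of the
    coefficients themselves. *)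

(** * The reciprocal Gamma function at integers and half-integers *)

Section RecipGamma.
Variable R : realType.
Implicit Types x : R.

Definition gauss x (n : nat) : R :=
  (\prod_(i < n.+1) (x + i%:R)) / (n`!%:R * n%:R `^ x).

Lemma rgammaE x : rgamma x = limn (gauss x).
Proof. by []. Qed.

Lemma gauss_shift x n : (0 < n)%N ->
  gauss x n * ((x + 1 + n%:R) / n%:R) = x * gauss (x + 1) n.
Proof.
move=> n0; rewrite /gauss.
have -> : \prod_(i < n.+1) (x + 1 + i%:R) =
    (\prod_(i < n) (x + 1 + i%:R)) * (x + 1 + n%:R).
  by rewrite big_ord_recr.
rewrite big_ord_recl /= addr0.
have -> : \prod_(i < n) (x + (bump 0 i)%:R) = \prod_(i < n) (x + 1 + i%:R).
  by apply: eq_bigr => i _; rewrite /bump add1n -natr1; ring.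
have nn : n%:R != 0 :> R by rewrite pnatr_eq0 -lt0n.
rewrite powRD ?nn ?implybT // powRr1 ?ler0n //.
have : n`!%:R != 0 :> R by rewrite pnatr_eq0 -lt0n fact_gt0.
have : n%:R `^ x != 0 :> R by rewrite gt_eqF // powR_gt0 // ltr0n.
by move=> h1 h2; field; rewrite h1 h2 nn.
Qed.

Lemma gauss_ratio_cvg x : (x + 1 + n%:R) / n%:R @[n --> \oo] --> (1 : R).
Proof.
have h : (x + 1) * n%:R^-1 + 1 @[n --> \oo] --> (x + 1) * 0 + 1.
  apply: cvgD; last exact: cvg_cst.
  apply: cvgM; first exact: cvg_cst.
  apply/gtr0_cvgV0; last exact: cvgr_idn.
  by exists 1%N => // n /= n0; rewrite ltr0n.
rewrite mulr0 add0r in h; apply: cvg_trans h.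
apply: near_eq_cvg; exists 1%N => // n /= n0.
by field; rewrite pnatr_eq0 -lt0n.
Qed.

(** The limit of [gauss_shift]. Convergence is carried upwards, from x to x + 1, so the base points
    are the smallest positive arguments in use, 1/2 and 1. *)
Lemma gauss_cvgS x : x != 0 -> cvgn (gauss x) ->
  cvgn (gauss (x + 1)) /\ rgamma x = x * rgamma (x + 1).
Proof.
move=> x0 cx.
have h : gauss (x + 1) n @[n --> \oo] --> x^-1 * (limn (gauss x) * 1).
  have h2 : x^-1 * (gauss x n * ((x + 1 + n%:R) / n%:R)) @[n --> \oo] -->
      x^-1 * (limn (gauss x) * 1).
    apply: cvgM; first exact: cvg_cst.
    by apply: cvgM; [exact: cx | exact: gauss_ratio_cvg].
  apply: cvg_trans h2; apply: near_eq_cvg; exists 1%N => // n /= n0.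
  by rewrite /= gauss_shift // mulrA mulVf // mul1r.
split; first by apply/cvg_ex; exists (x^-1 * (limn (gauss x) * 1)).
by rewrite !rgammaE (cvg_lim _ h) // mulr1 mulrA divff // mul1r.
Qed.

Lemma rgammaN (n : nat) : rgamma (- n%:R : R) = 0.
Proof.
rewrite rgammaE; apply: cvg_lim => //.
apply/subr_cvg0/cvgrPdist_lt => e e0; exists n => // m /= nm.
rewrite /gauss subr0 sub0r normrN.
have i : (n < m.+1)%N by [].
by rewrite (bigD1 (Ordinal i)) //= addrC subrr !mul0r normr0.
Qed.

Lemma gauss1_cvg : gauss 1 n @[n --> \oo] --> (1 : R).
Proof.
apply: cvg_trans (gauss_ratio_cvg 0).
apply: near_eq_cvg; exists 1%N => // n /= n0; rewrite /gauss.
have -> : \prod_(i < n.+1) (1 + i%:R) = (n.+1)`!%:R :> R.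
  elim: (n.+1) => [|m IH]; first by rewrite big_ord0.
  by rewrite big_ord_recr /= IH factS natrM mulrC -natr1 [1 + _]addrC.
rewrite powRr1 // factS natrM add0r -natr1.
have : n`!%:R != 0 :> R by rewrite pnatr_eq0 -lt0n fact_gt0.
move=> h; field.
by rewrite h andbT pnatr_eq0 -lt0n.
Qed.

(** The Gauss product at 1/2 freed of its sqrt n, to be compared with both sqrt n and sqrt (n +
    1). *)
Definition gauss_half_num (n : nat) : R := (\prod_(i < n.+1) (2^-1 + i%:R)) / n`!%:R.

Local Notation v := gauss_half_num.

Lemma gauss_half_numS n : v n.+1 = v n * ((n%:R + 3 / 2) / (n%:R + 1)).
Proof.
rewrite /gauss_half_num big_ord_recr /= factS natrM -natr1.
have : n`!%:R != 0 :> R by rewrite pnatr_eq0 -lt0n fact_gt0.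
have : n%:R + 1 != 0 :> R by rewrite natr1 pnatr_eq0.
by move=> h1 h2; field; rewrite h1 h2.
Qed.

Lemma gauss_half_num_gt0 n : 0 < v n.
Proof.
rewrite /gauss_half_num divr_gt0 ?ltr0n ?fact_gt0 //; apply: prodr_gt0 => i _.
by rewrite ltr_pwDl // invr_gt0.
Qed.

Lemma gauss_halfE n : gauss 2^-1 n = v n / Num.sqrt n%:R.
Proof. by rewrite /gauss powR12_sqrt // invfM mulrA. Qed.

Lemma gauss_half_decr n : (0 < n)%N -> gauss 2^-1 n.+1 <= gauss 2^-1 n.
Proof.
move=> n0; rewrite !gauss_halfE gauss_half_numS.
have nR : 0 < n%:R :> R by rewrite ltr0n.
have nS : 0 < n.+1%:R :> R by rewrite ltr0n.
rewrite ler_pdivrMr ?sqrtr_gt0 // [leRHS]mulrAC ler_pdivlMr ?sqrtr_gt0 //.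
rewrite -(mulrA (v n)) ler_pM2l ?gauss_half_num_gt0 //.
rewrite -(@ler_pXn2r _ 2%N) ?nnegrE ?mulr_ge0 ?sqrtr_ge0 ?divr_ge0 //; try lra.
have -> : n.+1%:R = n%:R + 1 :> R by rewrite natr1.
rewrite !exprMn !sqr_sqrtr; try lra.
rewrite exprVn.
rewrite [leLHS]mulrAC ler_pdivrMr; last by nra.
by nra.
Qed.

Lemma gauss_half_num_incr n : v n / Num.sqrt (n%:R + 1) <= v n.+1 / Num.sqrt (n%:R + 2).
Proof.
rewrite gauss_half_numS.
have nR : 0 <= n%:R :> R by [].
rewrite ler_pdivrMr ?sqrtr_gt0; last lra.
rewrite [leRHS]mulrAC ler_pdivlMr ?sqrtr_gt0; last lra.
rewrite -(mulrA (v n)) ler_pM2l ?gauss_half_num_gt0 //.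
rewrite -(@ler_pXn2r _ 2%N) ?nnegrE ?mulr_ge0 ?sqrtr_ge0 ?divr_ge0 //; try lra.
rewrite !exprMn !sqr_sqrtr; try lra.
rewrite exprVn [leRHS]mulrAC ler_pdivlMr; last nra.
by nra.
Qed.

(** A monotone squeeze replaces the value 1/sqrt pi: v n / sqrt n decreases and stays above v n /
    sqrt (n + 1), which increases from its first term 1/2. *)
Lemma gauss_half : cvgn (gauss 2^-1) /\ 0 < rgamma (2^-1 : R).
Proof.
have lb n : (0 < n)%N -> 2^-1 <= gauss 2^-1 n.
  move=> n0; apply: (@le_trans _ _ (v n / Num.sqrt (n%:R + 1))); last first.
    have n0' : 0 < n%:R :> R by rewrite ltr0n.
    rewrite gauss_halfE ler_pM2l ?gauss_half_num_gt0 // lef_pV2 ?posrE.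
    - by rewrite ler_sqrt; lra.
    - by rewrite sqrtr_gt0; lra.
    - by rewrite sqrtr_gt0.
  have e : 2^-1 = v 0 / Num.sqrt (0%:R + 1) :> R.
    by rewrite /gauss_half_num big_ord_recr big_ord0 /= mul1r add0r sqrtr1 !divr1 addr0.
  rewrite [leLHS]e; elim: n {n0} => [//|n IH].
  apply: (le_trans IH); apply: le_trans (gauss_half_num_incr n) _.
  by have -> : n.+1%:R + 1 = n%:R + 2 :> R by rewrite -natr1; ring.
have dec : nonincreasing_seq (fun n => gauss 2^-1 n.+1).
  by apply/nonincreasing_seqP => n; apply: gauss_half_decr.
have cv : cvgn (fun n => gauss 2^-1 n.+1).
  apply: nonincreasing_is_cvgn => //; exists 2^-1 => _ [n _ <-]; exact: lb.
have cv' : cvgn (gauss 2^-1).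
  by move: cv => /cvg_ex[l]; rewrite cvg_shiftS => h; apply/cvg_ex; exists l.
split => //; rewrite rgammaE.
apply: (@lt_le_trans _ _ 2^-1); first by rewrite invr_gt0.
by apply: limr_ge => //; exists 1%N => // n /= ; exact: lb.
Qed.

Lemma rgamma_halves (k : nat) : (0 < k)%N ->
  [/\ cvgn (gauss (k%:R / 2)), 0 < rgamma (k%:R / 2 : R) &
     rgamma (k%:R / 2) = k%:R / 2 * rgamma (k%:R / 2 + 1) :> R].
Proof.
have key x : 0 < x -> cvgn (gauss x) /\ 0 < rgamma x ->
    (cvgn (gauss (x + 1)) /\ 0 < rgamma (x + 1)) /\
    rgamma x = x * rgamma (x + 1).
  move=> x0 [cx rx]; have [c1 e] := gauss_cvgS (lt0r_neq0 x0) cx.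
  by split=> //; split => //; move: rx; rewrite e pmulr_rgt0.
suff {}key2 : (0 < k)%N -> cvgn (gauss (k%:R / 2)) /\ 0 < rgamma (k%:R / 2 : R).
  move=> k0; have [a b] := key2 k0; split => //.
  by apply: (key _ _ _).2; rewrite ?divr_gt0 ?ltr0n.
elim/ltn_ind: k => -[|[|[|k]]] // IH _.
- by rewrite mul1r; exact: gauss_half.
- rewrite divff ?pnatr_eq0 //; split; first by apply/cvg_ex; exists 1; exact: gauss1_cvg.
  by rewrite rgammaE (cvg_lim _ gauss1_cvg).
- have -> : k.+3%:R / 2 = k.+1%:R / 2 + 1 :> R by rewrite -2!natr1; field.
  apply: (key _ _ _).1; last exact: IH.
  by rewrite divr_gt0 ?ltr0n.
Qed.

Lemma rgamma_nat (n : nat) : rgamma (n.+1%:R : R) = n`!%:R^-1.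
Proof.
elim: n => [|n IH].
  by rewrite rgammaE (cvg_lim _ gauss1_cvg) // fact0 invr1.
have [] := @rgamma_halves (n.+1).*2; first by rewrite double_gt0.
have -> : n.+1.*2%:R / 2 = n.+1%:R :> R.
  by rewrite -muln2 natrM mulfK // pnatr_eq0.
move=> _ _; rewrite IH natr1 => e.
have n1 : n.+1%:R != 0 :> R by rewrite pnatr_eq0.
apply: (mulfI n1); rewrite -e factS natrM invfM mulrA divff // mul1r //.
Qed.

End RecipGamma.

(** * Hypergeometric coefficients and Jacobi polynomials *)

Section HypergeometricCoef.
Variable R : realType.
Implicit Types a b c z : R.

Definition hyp_coef a b c m : R :=
  pochhammer a m * pochhammer b m * rgamma (c + m%:R) / m`!%:R.

Lemma fact_neq0 n : n`!%:R != 0 :> R.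
Proof. by rewrite pnatr_eq0 -lt0n fact_gt0. Qed.

Lemma natrS n : n.+1%:R = n%:R + 1 :> R.
Proof. by rewrite natr1. Qed.

Lemma natrSS n : n.+2%:R = n%:R + 2 :> R.
Proof. by rewrite -addn2 natrD. Qed.

Lemma pochhammer0 a : pochhammer a 0 = 1.
Proof. by rewrite /pochhammer big_ord0. Qed.

Lemma pochhammerSr a m : pochhammer a m.+1 = pochhammer a m * (a + m%:R).
Proof. by rewrite /pochhammer big_ord_recr. Qed.

Lemma pochhammerSl a m : pochhammer a m.+1 = a * pochhammer (a + 1) m.
Proof.
elim: m => [|m IH]; first by rewrite pochhammerSr !pochhammer0 addr0 mulrC.
by rewrite pochhammerSr IH pochhammerSr -natr1; ring.
Qed.

Lemma pochhammerD a p m :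
  pochhammer a (p + m) = pochhammer a p * pochhammer (a + p%:R) m.
Proof.
elim: m => [|m IH]; first by rewrite addn0 pochhammer0 mulr1.
by rewrite addnS !pochhammerSr IH natrD; ring.
Qed.

Lemma pochhammerN n m : (n < m)%N -> pochhammer (- n%:R : R) m = 0.
Proof.
by move=> nm; rewrite /pochhammer (bigD1 (Ordinal nm)) //= addNr mul0r.
Qed.

Lemma rgamma_rec (k m : nat) : rgamma (k.+1%:R / 2 + m%:R) =
  (k.+1%:R / 2 + m%:R) * rgamma (k.+1%:R / 2 + m.+1%:R) :> R.
Proof.
have e : k.+1%:R / 2 + m%:R = (k.+1 + m.*2)%:R / 2 :> R.
  by rewrite natrD -muln2 natrM; field.
have -> : m.+1%:R = m%:R + 1 :> R by rewrite natrS.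
rewrite addrA e.
by have [] := @rgamma_halves R (k.+1 + m.*2).
Qed.

Lemma hyp_coefS a b k m :
  hyp_coef a b (k.+1%:R / 2) m.+1 = hyp_coef a b (k.+1%:R / 2) m *
    ((a + m%:R) * (b + m%:R) / ((m%:R + 1) * (k.+1%:R / 2 + m%:R))).
Proof.
rewrite /hyp_coef (rgamma_rec k m) !pochhammerSr factS natrM.
have -> : m.+1%:R = m%:R + 1 :> R by rewrite natr1.
have h1 := fact_neq0 m.
have h2 : m%:R + 1 != 0 :> R by rewrite natr1 pnatr_eq0.
have h3 : k.+1%:R / 2 + m%:R != 0 :> R.
  by rewrite gt_eqF // ltr_wpDr // divr_gt0.
move: (rgamma _) (pochhammer a m) (pochhammer b m) => x y t.
move: (k.+1%:R / 2) h3 => c h3.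
by field; rewrite h1 h2 h3.
Qed.

(** The Jacobi polynomial of degree n with both parameters (k-1)/2 (Gegenbauer, index k/2) in z = (1
    - x)/2, scaled to have the value 1/Gamma((k+1)/2) at z = 0. For x = cos theta its orthogonality
    weight is sin^k d theta, whence the parameter k. *)
Definition jac (n k : nat) : {poly R} :=
  \poly_(m < n.+1) hyp_coef (- n%:R) (n + k)%:R (k.+1%:R / 2) m.

Lemma coef_jac n k m :
  (jac n k)`_m = hyp_coef (- n%:R) (n + k)%:R (k.+1%:R / 2) m.
Proof.
rewrite coef_poly; case: ltnP => // nm.
by rewrite /hyp_coef pochhammerN // !mul0r.
Qed.

Lemma jac0 k : jac 0 k = (rgamma (k.+1%:R / 2))%:P.
Proof.
apply/polyP => -[|m]; rewrite coef_jac coefC /=.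
  by rewrite /hyp_coef !pochhammer0 fact0 divr1 !mul1r addr0.
by rewrite /hyp_coef (@pochhammerN 0) // !mul0r.
Qed.

Lemma horner_jac0 n k : (jac n k).[0] = rgamma (k.+1%:R / 2).
Proof.
by rewrite horner_coef0 coef_jac /hyp_coef !pochhammer0 fact0 divr1 !mul1r addr0.
Qed.

(** Differentiation raises all three hypergeometric parameters by one, which here is the move from
    (n + 1, k) to (n, k + 2); [jac_rodrigues] goes back. *)
Lemma deriv_jac n k : (jac n.+1 k)^`() =
  - (n.+1%:R * (n.+1 + k)%:R) *: jac n k.+2.
Proof.
apply/polyP => m; rewrite coef_deriv coefZ !coef_jac /hyp_coef !pochhammerSl.
have -> : - n.+1%:R + 1 = - n%:R :> R by rewrite -natr1; ring.
have -> : (n.+1 + k)%:R + 1 = (n + k.+2)%:R :> R by rewrite natr1 !addnS.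
have -> : k.+1%:R / 2 + m.+1%:R = k.+3%:R / 2 + m%:R :> R.
  by rewrite (natrSS k.+1) (natrS m); field.
rewrite -mulr_natl factS natrM.
have h1 := fact_neq0 m.
have h2 : m.+1%:R != 0 :> R by rewrite pnatr_eq0.
move: (rgamma _) (pochhammer _ m) (pochhammer _ m) => x y t.
by field; rewrite h1 nat1r h2.
Qed.

(* The Rodrigues recurrence: up to the factor 1/2 and a power of z(1-z), jac n.+1 k
   is the derivative of (z(1-z))^((k+1)/2) * jac n k.+2. *)
Lemma jac_rodrigues n k : jac n.+1 k =
  ('X - 'X ^+ 2) * (jac n k.+2)^`() +
  (k.+1%:R / 2) *: ((1 - 2 *: 'X) * jac n k.+2).
Proof.
set e := jac n k.+2.
have -> : ('X - 'X ^+ 2) * e^`() + (k.+1%:R / 2) *: ((1 - 2 *: 'X) * e) =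
    'X * e^`() - 'X * ('X * e^`()) + (k.+1%:R / 2) *: e - k.+1%:R *: ('X * e).
  rewrite !mulrBl mul1r scalerBr -scalerAl scalerA divfK ?pnatr_eq0 //.
  by rewrite expr2 -mulrA addrA.
apply/polyP => -[|m].
  rewrite coef_jac !(coefD, coefN, coefZ, coefXM) /=.
  rewrite !(subr0, mulr0, add0r) /e coef_jac /hyp_coef !pochhammer0 fact0 !divr1 !mul1r !addr0.
  have := rgamma_rec k 0; rewrite addr0 => ->; congr (_ * rgamma _).
  by rewrite natrSS; field.
rewrite !(coefD, coefN, coefZ, coefXM) /=.
have -> : (if m == 0%N then 0 else e^`()`_m.-1) = m%:R * e`_m.
  by case: m => [|m] /=; rewrite ?mul0r // coef_deriv mulr_natl.
have -> : e^`()`_m = m.+1%:R * e`_m.+1 by rewrite coef_deriv mulr_natl.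
rewrite /e !coef_jac /hyp_coef.
have -> : k.+3%:R / 2 + m%:R = k.+1%:R / 2 + m.+1%:R :> R.
  by rewrite (natrSS k.+1) (natrS m); field.
have -> : k.+3%:R / 2 + m.+1%:R = k.+1%:R / 2 + m.+2%:R :> R.
  by rewrite (natrSS k.+1) (natrS m.+1); field.
rewrite (rgamma_rec k m.+1).
rewrite [pochhammer (- n.+1%:R) _]pochhammerSl.
rewrite [pochhammer (n.+1 + k)%:R _]pochhammerSl.
have -> : - n.+1%:R + 1 = - n%:R :> R by rewrite -natr1; ring.
have -> : (n.+1 + k)%:R + 1 = (n + k.+2)%:R :> R by rewrite natr1 !addnS.
rewrite !pochhammerSr factS natrM.
have h1 := fact_neq0 m.
have h2 : m.+1%:R != 0 :> R by rewrite pnatr_eq0.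
move: (rgamma _) (pochhammer _ m) (pochhammer _ m) => x y t.
have -> : (n + k.+2)%:R = n%:R + k%:R + 2 :> R by rewrite natrD (natrSS k) addrA.
have -> : (n.+1 + k)%:R = n%:R + k%:R + 1 :> R by rewrite addSn natrS natrD.
rewrite (natrS n) (natrS k) (natrS m) in h2 *.
by field; rewrite h1 h2.
Qed.

End HypergeometricCoef.

(** * Power series with bounded coefficients on (-1, 1) *)

Section BoundedCoefficients.
Variable R : realType.
Implicit Types (c : R^nat) (r s x : R).

Definition geom_bounded c r := exists M, forall i, `|c i| * r ^+ i <= M.

(** Bernoulli's inequality with h = r/s - 1 bounds the factor i + 1 created by differentiation by (1
    + 1/h) (r/s)^i, which the smaller radius pays for. *)
Lemma geom_bounded_diffs c r s :
  0 < s -> s < r -> geom_bounded c r -> geom_bounded (pseries_diffs c) s.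
Proof.
move=> s0 sr [M hM].
have r0 : 0 < r by apply: lt_trans sr.
have M0 : 0 <= M by apply: le_trans (hM 0%N); rewrite expr0 mulr1.
pose h := r / s - 1.
have h0 : 0 < h by rewrite /h subr_gt0 ltr_pdivlMr // mul1r.
have bern i : 1 + i%:R * h <= (r / s) ^+ i.
  elim: i => [|i IH]; first by rewrite mul0r addr0 expr0.
  have e : r / s = 1 + h by rewrite /h addrC subrK.
  rewrite exprS {1}e natrS; apply: (@le_trans _ _ ((1 + h) * (1 + i%:R * h))).
    have : 0 <= i%:R * h * h by rewrite !mulr_ge0 // ltW.
    by lra.
  by apply: ler_wpM2l => //; lra.
exists (M / r * (1 + h^-1)) => i; rewrite /pseries_diffs.
have hi := hM i.+1.
have ei : r ^+ i.+1 = s ^+ i * (r / s) ^+ i * r.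
  by rewrite -exprMn mulrCA divff ?gt_eqF // mulr1 exprSr.
rewrite normrM normr_nat.
have si : 0 < s ^+ i by rewrite exprn_gt0.
have A0 : 0 <= `|c i.+1| * s ^+ i by rewrite mulr_ge0 // ltW.
have h1 : i.+1%:R <= (1 + h^-1) * (r / s) ^+ i.
  have hV : 0 < h^-1 by rewrite invr_gt0.
  apply: (@le_trans _ _ ((1 + h^-1) * (1 + i%:R * h))).
    rewrite natrS.
    have -> : (1 + h^-1) * (1 + i%:R * h) = i%:R + 1 + (h^-1 + i%:R * h).
      by field; rewrite gt_eqF.
    by rewrite lerDl addr_ge0 ?mulr_ge0 // ltW.
  by apply: ler_wpM2l (bern i); lra.
have h2 : `|c i.+1| * s ^+ i * (r / s) ^+ i <= M / r.
  by rewrite ler_pdivlMr //; move: hi; rewrite ei !mulrA.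
rewrite -(mulrA i.+1%:R); apply: le_trans (ler_wpM2r A0 h1) _.
rewrite -(mulrA (1 + h^-1)) [_ ^+ i * _]mulrC [leRHS]mulrC.
by apply: ler_wpM2l h2; rewrite addr_ge0 // invr_ge0 ltW.
Qed.

Lemma geom_bounded_cvg c r s : 0 <= s < r -> geom_bounded c r ->
  cvgn (pseries c s).
Proof.
move=> /andP[s0 sr] [M hM].
have r0 : 0 < r by apply: le_lt_trans sr.
have M0 : 0 <= M by apply: le_trans (hM 0%N); rewrite expr0 mulr1.
apply: normed_cvg; rewrite /normed_series_of /=.
apply: (@series_le_cvg _ _ (geometric M (s / r))) => [n|n|n|] //=.
- by rewrite mulr_ge0 // exprn_ge0 // divr_ge0 // ltW.
- rewrite normrM (ger0_norm (exprn_ge0 _ s0)).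
  have -> : s ^+ n = r ^+ n * (s / r) ^+ n.
    by rewrite -exprMn mulrCA divff ?gt_eqF // mulr1.
  by rewrite mulrA; apply: ler_wpM2r (hM n); rewrite exprn_ge0 // divr_ge0 // ltW.
- apply: is_cvg_geometric_series.
  by rewrite ger0_norm ?divr_ge0 ?ltr_pdivrMr ?mul1r // ltW.
Qed.

Lemma geom_bounded_is_derive c x : geom_bounded c 1 -> `|x| < 1 ->
  is_derive x (1 : R) (fun x => limn (pseries c x))
    (limn (pseries (pseries_diffs c) x)).
Proof.
move=> c1 x1; have x0 := normr_ge0 x.
(* [pseries_snd_diffs] wants the series and its first two formal derivatives to converge at some s >
   |x|. Each differentiation loses some radius, so |x| < s < r1 < r2 < 1 are successive
   midpoints. *)
pose s := (1 + `|x|) / 2; pose r1 := (1 + s) / 2; pose r2 := (1 + r1) / 2.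
have Hs : `|x| < s by rewrite /s; lra.
have Hs1 : s < 1 by rewrite /s; lra.
have s0 : 0 < s by lra.
have Hr1 : s < r1 by rewrite /r1; lra.
have Hr11 : r1 < 1 by rewrite /r1; lra.
have Hr2 : r1 < r2 by rewrite /r2; lra.
have Hr21 : r2 < 1 by rewrite /r2; lra.
have d1 : geom_bounded (pseries_diffs c) r2.
  by apply: geom_bounded_diffs c1 => //; lra.
have d2 : geom_bounded (pseries_diffs (pseries_diffs c)) r1.
  by apply: geom_bounded_diffs d1 => //; lra.
apply: (@pseries_snd_diffs _ c s).
- by apply: geom_bounded_cvg c1; lra.
- by apply: geom_bounded_cvg d1; lra.
- by apply: geom_bounded_cvg d2; lra.
- by rewrite [X in _ < X]gtr0_norm.
Qed.

Lemma geom_bounded_cvg_in c x : geom_bounded c 1 -> `|x| < 1 ->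
  cvgn (pseries c x) /\ cvgn (pseries (pseries_diffs c) x).
Proof.
move=> c1 x1; have x0 := normr_ge0 x.
pose s := (1 + `|x|) / 2; pose r1 := (1 + s) / 2.
have Hs : `|x| < s by rewrite /s; lra.
have Hs1 : s < 1 by rewrite /s; lra.
have Hr1 : s < r1 by rewrite /r1; lra.
have Hr11 : r1 < 1 by rewrite /r1; lra.
have sx : `|x| < `|s| by rewrite [X in _ < X]gtr0_norm //; lra.
have d1 : geom_bounded (pseries_diffs c) r1.
  by apply: geom_bounded_diffs c1 => //; lra.
split; apply: is_cvg_pseries_inside sx.
- by apply: geom_bounded_cvg c1; lra.
- by apply: geom_bounded_cvg d1; lra.
Qed.

Lemma eventually_decreasing_bounded c N :
  (forall m, (N <= m)%N -> `|c m.+1| <= `|c m|) -> geom_bounded c 1.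
Proof.
move=> hN; exists (\sum_(i < N.+1) `|c i|) => m; rewrite expr1n mulr1.
have base i : (i < N.+1)%N -> `|c i| <= \sum_(i < N.+1) `|c i|.
  by move=> iN; rewrite (bigD1 (Ordinal iN)) //= lerDl sumr_ge0.
have [mN|Nm] := ltnP m N.+1; first exact: base.
rewrite -(subnKC (ltnW Nm)); elim: (m - N)%N => [|p IH].
  by rewrite addn0; apply: base.
by rewrite addnS; apply: le_trans IH; apply: hN; rewrite leq_addr.
Qed.

End BoundedCoefficients.

(** * Euler's transformation at the Legendre parameters *)

Section LegendreHypergeometric.
Variable R : realType.
Implicit Types a b c z : R.

(** As a + b = 1, the ratio of consecutive coefficients is (m^2 + m + ab) / ((m + 1)(c + m)) with c
    > 0. Since ab <= 0 it is at most 1, and it is nonnegative once m >= -ab. *)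
Lemma hyp_coef_bounded a b k : a + b = 1 -> a * b <= 0 ->
  geom_bounded (hyp_coef a b (k.+1%:R / 2)) 1.
Proof.
move=> ab1 ab0; apply: (@eventually_decreasing_bounded _ _ (Num.bound (- (a * b)))).
move=> m hm; rewrite hyp_coefS normrM ler_piMr //.
have m0 : 0 <= m%:R :> R by [].
have k0 : 0 < k.+1%:R / 2 :> R by rewrite divr_gt0.
have h1 : - (a * b) <= m%:R.
  have : - (a * b) < (Num.bound (- (a * b)))%:R by apply: archi_boundP; lra.
  have : (Num.bound (- (a * b)))%:R <= m%:R :> R by rewrite ler_nat.
  by lra.
have e : (a + m%:R) * (b + m%:R) = a * b + m%:R + m%:R ^+ 2.
  have -> : b = 1 - a by lra.
  ring.
move: (k.+1%:R / 2) k0 => c c0.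
have d0 : 0 < (m%:R + 1) * (c + m%:R) by apply: mulr_gt0; lra.
have m2 : 0 <= m%:R ^+ 2 :> R by rewrite exprn_ge0.
rewrite e ger0_norm; last by apply: divr_ge0; [lra | exact: ltW].
rewrite ler_pdivrMr // mul1r.
have -> : (m%:R + 1) * (c + m%:R) = m%:R + m%:R ^+ 2 + (c * m%:R + c) by ring.
have : 0 <= c * m%:R by rewrite mulr_ge0 // ltW.
lra.
Qed.

(** Coefficientwise form of mu F + (1 - z) F' = (c - a)(c - b) F(c + 1), where c = (k+1)/2 and mu =
    c - 1 = c - a - b is the exponent of Euler's transformation. The left side is (1 - z)^(mu + 1)
    times the derivative of (1 - z)^(-mu) F. *)
Lemma hyp_coef_contiguous a b k m : a + b = 1 ->
  let mu := (k%:R - 1) / 2 in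
  let e := hyp_coef a b (k.+1%:R / 2) in
  mu * e m + (pseries_diffs e m - m%:R * e m) =
  (mu * (mu + 1) + a * b) * hyp_coef a b (k.+3%:R / 2) m.
Proof.
move=> ab1 /=; rewrite /pseries_diffs.
have eb : b = 1 - a by lra.
rewrite /hyp_coef (rgamma_rec R k m) !pochhammerSr factS natrM.
have -> : k.+3%:R / 2 + m%:R = k.+1%:R / 2 + m.+1%:R :> R.
  by rewrite (natrSS R k.+1) (natrS R m); field.
have h1 := fact_neq0 R m.
have h2 : m.+1%:R != 0 :> R by rewrite pnatr_eq0.
move: (rgamma _) (pochhammer a m) (pochhammer b m) => x y t.
rewrite eb (natrS R k) (natrS R m) in h2 *.
by field; rewrite h1 h2.
Qed.

Lemma hyp2F1reg_contiguous a b k z : a + b = 1 -> a * b <= 0 -> `|z| < 1 ->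
  let mu := (k%:R - 1) / 2 in
  let e := hyp_coef a b (k.+1%:R / 2) in
  mu * limn (pseries e z) + (1 - z) * limn (pseries (pseries_diffs e) z) =
  (mu * (mu + 1) + a * b) * limn (pseries (hyp_coef a b (k.+3%:R / 2)) z).
Proof.
move=> ab1 ab0 z1 mu e.
have [c1 c2] := geom_bounded_cvg_in (hyp_coef_bounded k ab1 ab0) z1.
have [c3 _] := geom_bounded_cvg_in (hyp_coef_bounded k.+2 ab1 ab0) z1.
have h := pseries_diffs_equiv c2; rewrite -/e in c1 c2 h.
have L : mu * pseries e z n + (pseries (pseries_diffs e) z n -
     z * series (fun i => i%:R * e i * z ^+ i.-1) n) @[n --> \oo] -->
   mu * limn (pseries e z) + (limn (pseries (pseries_diffs e) z) -
     z * limn (pseries (pseries_diffs e) z)).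
  apply: cvgD; first by apply: cvgM; [exact: cvg_cst|exact: c1].
  apply: cvgB; first exact: c2.
  by apply: cvgM; [exact: cvg_cst|exact: h].
have L' : (mu * (mu + 1) + a * b) *
    pseries (hyp_coef a b (k.+3%:R / 2)) z n @[n --> \oo] -->
    (mu * (mu + 1) + a * b) * limn (pseries (hyp_coef a b (k.+3%:R / 2)) z).
  by apply: cvgM; [exact: cvg_cst|exact: c3].
rewrite mulrBl mul1r.
apply: (cvg_unique _ L) => //; apply: cvg_trans L'; apply: near_eq_cvg.
apply: nearW => n; rewrite /pseries /series /= !mulr_sumr -sumrB -big_split /=.
apply: eq_bigr => i _; rewrite (mulrA _ (hyp_coef _ _ _ i)) -hyp_coef_contiguous // -/mu -/e.
rewrite mulrDl mulrBl !mulrA; congr (_ + (_ - _)).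
case: i => [|i] /=; first by rewrite mulr0 !mul0r.
by rewrite exprS; ring.
Qed.

Lemma limn_pseries0 (c : R^nat) : limn (pseries c 0) = c 0%N.
Proof.
apply: lim_near_cst => //; exists 1%N => // -[//|m] _.
rewrite /pseries /series /= big_nat_recl //= expr0 mulr1 big1 ?addr0 // => i _.
by rewrite exprS mul0r mulr0.
Qed.

(* G t = (1 - t)^(- mu) f t - p.[t] has zero derivative. *)
Lemma ode_solution (mu : R) (f f' : R -> R) (p : {poly R}) :
  (forall t, `|t| < 1 -> is_derive t (1 : R) f (f' t)) ->
  (forall t, 0 < t < 1 ->
     mu * f t + (1 - t) * f' t = (1 - t) `^ (mu + 1) * p^`().[t]) ->
  f 0 = p.[0] ->
  forall z, 0 <= z < 1 -> f z = (1 - z) `^ mu * p.[z].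
Proof.
move=> df ode f0 z /andP[z0 z1].
pose G t := (1 - t) `^ (- mu) * f t - p.[t].
pose dG t := mu * (1 - t) `^ (- mu - 1) * f t + (1 - t) `^ (- mu) * f' t - p^`().[t].
have dG' t : `|t| < 1 -> is_derive t (1 : R) G (dG t).
  move=> t1; have t1' : 0 < 1 - t by rewrite subr_gt0 (le_lt_trans (ler_norm t)).
  have d1 : is_derive t (1 : R) (fun t => 1 - t) (- 1).
    by apply: is_derive_eq; ring.
  have d2 := is_derive1_powR (- mu) t1'.
  have d3 : is_derive t (1 : R) (fun t => (1 - t) `^ (- mu))
      (mu * (1 - t) `^ (- mu - 1)).
    have h := @is_derive1_comp _ (fun x => x `^ (- mu)) (fun t => 1 - t) t _ _ d2 d1.
    by apply: (is_derive_eq h); ring.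
  have d4 := df t t1.
  have d5 : is_derive t (1 : R) (fun t => p.[t]) p^`().[t] by exact: is_derive_poly.
  apply: (is_derive_eq (is_deriveB (is_deriveM d3 d4) d5)).
  by rewrite /dG /GRing.scale /=; ring.
have dG0 t : 0 < t < 1 -> dG t = 0.
  move=> /andP[t0 t1]; have t1' : 0 < 1 - t by rewrite subr_gt0.
  have nz : 1 - t != 0 by rewrite gt_eqF.
  have e1 : (1 - t) `^ (- mu) = (1 - t) `^ (- mu - 1) * (1 - t).
    by rewrite -[X in _ = _ * X]powRr1 ?(ltW t1') // -powRD ?subrK // nz implybT.
  have -> : dG t = (1 - t) `^ (- mu - 1) * (mu * f t + (1 - t) * f' t) - p^`().[t].
    by rewrite /dG e1; ring.
  rewrite ode ?t0 // mulrA -powRD ?nz ?implybT //.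
  have -> : - mu - 1 + (mu + 1) = 0 by ring.
  by rewrite powRr0 mul1r subrr.
have Gz : G z = 0.
  have G0 : G 0 = 0 by rewrite /G subr0 powR1 mul1r f0 subrr.
  have [->//|zn0] := eqVneq z 0.
  have zp : 0 < z by rewrite lt_neqAle eq_sym zn0.
  have [t||t ht] := @MVT R G dG 0 z zp.
  - rewrite in_itv /= => /andP[t0 tz]; apply: dG'.
    by rewrite gtr0_norm // (lt_trans tz).
  - apply: derivable_within_continuous => t; rewrite in_itv /= => /andP[t0 tz].
    apply: ex_derive; apply: dG'; rewrite ger0_norm //.
    exact: le_lt_trans z1.
  - rewrite G0 subr0 => ->; rewrite dG0 ?mul0r //.
    by move: ht; rewrite in_itv /= => /andP[-> tz]; exact: lt_trans z1.
have z1' : 0 < 1 - z by rewrite subr_gt0.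
move/eqP: Gz; rewrite /G subr_eq0 => /eqP <-.
rewrite mulrA -powRD; last by rewrite (gt_eqF z1') implybT.
by rewrite subrr powRr0 mul1r.
Qed.

(** Induction on n with nu fixed: passing from (n + 1, k) to (n, k + 2) keeps nu and raises mu by
    one. By the contiguous relation and [deriv_jac], (1 - z)^(-mu) F and the polynomial have the
    same derivative, with the same constant -(n + 1)(n + 1 + k), and the same value at 0. For n = 0
    one has nu = mu and the constant is 0. *)
Lemma hyp2F1reg_jac n k z : (0 < k)%N -> 0 <= z < 1 ->
  let nu := n%:R + (k%:R - 1) / 2 in
  hyp2F1reg (nu + 1) (- nu) (k.+1%:R / 2) z =
  (1 - z) `^ ((k%:R - 1) / 2) * (jac R n k).[z].
Proof.
elim: n k z => [|n IH] k z k0 hz nu.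
all: set mu := (k%:R - 1) / 2.
all: have mu0 : 0 <= mu by rewrite /mu divr_ge0 // subr_ge0 ler1n.
all: have nu0 : 0 <= nu by rewrite /nu addr_ge0.
all: have ab1 : (nu + 1) + - nu = 1 by ring.
all: have ab0 : (nu + 1) * - nu <= 0 by rewrite mulrN oppr_le0 mulr_ge0 // addr_ge0.
all: have be := hyp_coef_bounded k ab1 ab0.
all: apply: (@ode_solution mu _ _ (jac R _ k)
       (fun t ht => geom_bounded_is_derive be ht) _ _ _ hz).
all: rewrite ?limn_pseries0 ?horner_jac0 /hyp_coef
       ?pochhammer0 ?fact0 ?divr1 ?mul1r ?addr0 //.
all: move=> t /andP[t0 t1].
all: have t1' : `|t| < 1 by rewrite gtr0_norm.
all: rewrite -/(hyp_coef _ _ _) (hyp2F1reg_contiguous k ab1 ab0 t1') -/mu.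
- have -> : mu * (mu + 1) + (nu + 1) * - nu = 0 by rewrite /nu add0r -/mu; ring.
  by rewrite mul0r jac0 derivC horner0 mulr0.
- have -> : mu * (mu + 1) + (nu + 1) * - nu = - (n.+1%:R * (n.+1 + k)%:R).
    by rewrite /nu -/mu natrD /mu; field.
  rewrite deriv_jac hornerZ mulrCA; congr (_ * _).
  have -> : mu + 1 = (k.+2%:R - 1) / 2 by rewrite natrSS /mu; field.
  rewrite -IH ?(ltW t0) //.
  have -> // : n%:R + (k.+2%:R - 1) / 2 = nu.
  by rewrite /nu natrSS natrS; field.
Qed.

End LegendreHypergeometric.

(** * Closed form of the Legendre factors *)

Section LegendreClosedForm.
Variable R : realType.
Implicit Types (th mu x z : R) (L l : int).

(** For A = 1 + cos theta, B = 1 - cos theta, s = sin theta this merges the prefactor of the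
    Legendre function with the power of 1 - z from Euler's transformation. With A and B exchanged it
    serves negative l. *)
Lemma powR_half_angle (A B s mu : R) : 0 < A -> 0 < B -> 0 < s ->
  s ^+ 2 = A * B ->
  (A / B) `^ (- mu / 2) * (A / 2) `^ mu = s `^ mu * 2 `^ (- mu).
Proof.
move=> A0 B0 s0 e.
have els : ln s = (ln A + ln B) / 2.
  by rewrite -lnM // -e lnXn // mulr2n; field.
rewrite /powR !gt_eqF ?divr_gt0 // -!expRD; congr expR.
by rewrite !ln_div ?posrE // els; field.
Qed.

(** The series is a finite sum: terms below m vanish because 1/Gamma is 0 at the nonpositive
    integers 1 - m + i, terms above N because (-N)_i is. The remaining ones, shifted by m, are the
    coefficients of a Jacobi polynomial. *)
Lemma hyp2F1reg_neg_order (N m : nat) z : (m <= N)%N ->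
  hyp2F1reg (N%:R + 1) (- N%:R) (1 - m%:R) z =
  pochhammer (N%:R + 1) m * pochhammer (- N%:R) m * z ^+ m *
  (jac R (N - m) m.*2.+1).[z].
Proof.
move=> mN; set n := (N - m)%N.
have eN : N%:R = n%:R + m%:R :> R by rewrite -natrD subnK.
apply: lim_near_cst => //; exists (m + n.+1)%N => // p /= hp.
rewrite /series /= (@big_cat_nat _ _ _ m) //=; last first.
  by apply: leq_trans hp; rewrite leq_addr.
rewrite big_nat_cond big1 ?add0r; last first.
  move=> i; rewrite andbT => /andP[_ im].
  have -> : 1 - m%:R + i%:R = - (m - i.+1)%:R :> R.
    by rewrite natrB // natrS; ring.
  by rewrite rgammaN mulr0 !mul0r.
rewrite (@big_cat_nat _ _ _ (m + n.+1)%N) ?leq_addr //=.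
rewrite [X in _ + X]big_nat_cond [X in _ + X]big1 ?addr0; last first.
  move=> i; rewrite andbT => /andP[im _].
  have Ni : (N < i)%N by apply: leq_trans im; rewrite addnS ltnS /n subnKC.
  by rewrite pochhammerN // mulr0 !mul0r.
rewrite -{1}[m]add0n big_addn addKn big_mkord horner_poly mulr_sumr.
apply: eq_bigr => i _; rewrite /hyp_coef [(i + m)%N]addnC !pochhammerD exprD.
have -> : - N%:R + m%:R = - n%:R :> R by rewrite eN; ring.
have -> : N%:R + 1 + m%:R = (n + m.*2.+1)%:R :> R.
  by rewrite eN natrD natrS -muln2 natrM; ring.
have -> : 1 - m%:R + (m + i)%:R = i.+1%:R :> R by rewrite natrD natrS; ring.
have -> : m.*2.+2%:R / 2 + i%:R = (m + i).+1%:R :> R.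
  by rewrite (natrSS R m.*2) -muln2 natrM (natrS R (m + i)) natrD; field.
rewrite !rgamma_nat.
by ring.
Qed.

(** The Pochhammer product for l < 0 is (-1)^m (L + m)! / (L - m)! with m = |l|, the classical ratio
    between the Legendre functions of orders m and -m. *)
Definition legendre_cst (j : nat) L l : R :=
  legendre_coef R j L l * 2 `^ (- (`|l|%N%:R + (j%:R - 2) / 2)) *
  (if l < 0 then pochhammer (L%:~R + 1) `|l|%N * pochhammer (- L%:~R) `|l|%N
   else 1).

Definition legendre_fun (j : nat) L l th : R :=
  legendre_cst j L l * sin th ^+ `|l|%N *
  (jac R (`|L| - `|l|) (`|l|.*2 + j - 1)).[(1 - cos th) / 2].

(** What an index set element guarantees for L = l_j and l = l_(j-1): the order may be negative only
    if it is l_1, that is for j = 2. *)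
Definition legendre_index (j : nat) L l :=
  [&& (2 <= j)%N, `|l| <= L & (0 <= l) || (j == 2%N)].

(** For l >= 0 put mu = l + (j-2)/2 and k = 2 mu + 1. The power sin^((2-j)/2) of the definition
    cancels against sin^mu from [powR_half_angle] and leaves the integral power sin^l, so that the
    right side is continuous up to 0 and pi. *)
Lemma legendre_tilde_intE j L l th : legendre_index j L l -> 0 < th < pi ->
  legendre_tilde_int j L l th = legendre_fun j L l th.
Proof.
move=> /and3P[j2 lL hl] hth.
have s0 : 0 < sin th by rewrite sin_gt0_pi.
have s2 : sin th ^+ 2 = (1 + cos th) * (1 - cos th).
  by rewrite sin2cos2; ring.
have A0 : 0 < 1 + cos th.
  rewrite lt_neqAle; apply/andP; split; last by have := cos_geN1 th; lra.
  by apply/negP => /eqP e; move: s2; rewrite -e mul0r => /eqP; rewrite sqrf_eq0 gt_eqF.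
have B0 : 0 < 1 - cos th.
  rewrite lt_neqAle; apply/andP; split; last by have := cos_le1 th; lra.
  by apply/negP => /eqP e; move: s2; rewrite -e mulr0 => /eqP; rewrite sqrf_eq0 gt_eqF.
set z := (1 - cos th) / 2.
have z1 : 1 - z = (1 + cos th) / 2 by rewrite /z; field.
have hz : 0 <= z < 1 by rewrite /z; lra.
have z0 : 0 <= z by case/andP: hz.
rewrite /legendre_fun -/z /legendre_tilde_int /legendreP -/z /legendre_cst.
case: L lL => [N|N]; last by [].
rewrite -abszE lez_nat; set m := `|l|%N => mN; rewrite absz_nat.
have [l0|l0] := leP 0 l.
- have -> : l = m%:Z by rewrite /m gez0_abs.
  set nu := N%:R + (j%:R - 2) / 2; set mu := m%:R + (j%:R - 2) / 2.
  set k := (m.*2 + j - 1)%N.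
  have ek : k%:R = 2 * m%:R + j%:R - 1 :> R.
    by rewrite /k natrB ?natrD -?muln2 ?natrM ?[_ * 2]mulrC // addn_gt0 (ltnW j2) orbT.
  have emu : mu = (k%:R - 1) / 2 by rewrite ek /mu; field.
  have -> : nu = (N - m)%:R + (k%:R - 1) / 2 by rewrite -emu natrB // /nu /mu; ring.
  have -> : 1 - - mu = k.+1%:R / 2 by rewrite natrS emu; field.
  rewrite hyp2F1reg_jac //; last by rewrite /k subn_gt0 ltn_addl.
  rewrite -emu z1 mulr1.
  have e := powR_half_angle mu A0 B0 s0 s2.
  have es : sin th ^+ m = sin th `^ ((2 - j%:R) / 2) * sin th `^ mu.
    rewrite -powRD; last by rewrite (gt_eqF s0) implybT.
    rewrite -(powR_mulrn _ (ltW s0)).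
    by congr (_ `^ _); rewrite /mu; field.
  rewrite es -!mulrA; congr (_ * _); rewrite [RHS]mulrCA; congr (_ * _).
  by rewrite !mulrA e; ring.
- have j2' : j = 2 by move: hl; rewrite leNgt l0 => /eqP.
  have -> : l = - m%:Z by rewrite /m ltz0_abs ?opprK.
  rewrite j2' {j2 hl}.
  have -> : (2%:R - 2) / 2 = 0 :> R by field.
  rewrite powRr0 mulr1 !addr0 rmorphN /= opprK.
  rewrite hyp2F1reg_neg_order //.
  (* The roles of 1 + cos and 1 - cos are exchanged: the order is now positive, and the power z^m
     comes from the shifted series. *)
  have e := powR_half_angle m%:R B0 A0 s0 (etrans s2 (mulrC _ _)).
  have -> : (m.*2 + 2 - 1)%N = m.*2.+1 by rewrite addn2 subn1.
  rewrite -(powR_mulrn _ z0) -(powR_mulrn _ (ltW s0)).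
  have e' : ((1 + cos th) / (1 - cos th)) `^ (m%:R / 2) =
            ((1 - cos th) / (1 + cos th)) `^ (- m%:R / 2).
    rewrite /powR !gt_eqF ?divr_gt0 // !ln_div ?posrE //; congr expR.
    by ring.
  rewrite -!pmulrn e' -/z; rewrite -/z in e.
  transitivity (legendre_coef R 2 N (- m%:Z) *
    (((1 - cos th) / (1 + cos th)) `^ (- m%:R / 2) * z `^ m%:R) *
    (pochhammer (N%:R + 1) m * pochhammer (- N%:R) m *
    (jac R (N - m) m.*2.+1).[z])); first by ring.
  by rewrite e; ring.
Qed.

Lemma continuous_horner (p : {poly R}) : continuous (horner p).
Proof.
move=> x; apply: differentiable_continuous; apply/derivable1_diffP.
by apply: ex_derive; exact: is_derive_poly.
Qed.

Lemma continuous_legendre_fun j L l : continuous (legendre_fun j L l).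
Proof.
move=> th; apply: cvgM.
  apply: cvgM; first exact: cvg_cst.
  exact: (continuous_comp (@continuous_sin R th) (@exprn_continuous R _ _)).
have h : {for th, continuous (fun t : R => (1 - cos t) / 2)}.
  apply: cvgM; last exact: cvg_cst.
  by apply: cvgB; [exact: cvg_cst | exact: continuous_cos].
exact: (continuous_comp h (@continuous_horner _ _)).
Qed.

Lemma legendre_tildeE j L l th : legendre_index j L l -> 0 <= th <= pi ->
  legendre_tilde j L l th = legendre_fun j L l th.
Proof.
move=> hj /andP[t0 tpi]; rewrite /legendre_tilde.
case: ifPn => [ht|ht]; first exact: legendre_tilde_intE.
case: ifPn => [h0|h0].
  have -> : th = 0 by apply/eqP; rewrite eq_le h0.
  apply: cvg_lim => //.
  have h := @continuous_legendre_fun j L l 0.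
  have h' : legendre_fun j L l t @[t --> 0^'+] --> legendre_fun j L l 0.
    exact: cvg_at_right_filter.
  apply: cvg_trans h'; apply: near_eq_cvg; near=> t.
  apply/esym/legendre_tilde_intE => //; apply/andP; split => //.
  by near: t; apply: nbhs_right_lt; exact: pi_gt0.
have -> : th = pi.
  apply/eqP; rewrite eq_le tpi leNgt; apply: contra ht => ->.
  by rewrite andbT ltNge.
apply: cvg_lim => //.
have h := @continuous_legendre_fun j L l pi.
have h' : legendre_fun j L l t @[t --> pi^'-] --> legendre_fun j L l pi.
  exact: cvg_at_left_filter.
apply: cvg_trans h'; apply: near_eq_cvg; near=> t.
apply/esym/legendre_tilde_intE => //; apply/andP; split => //.
by near: t; apply: nbhs_left_gt; exact: pi_gt0.
Unshelve. all: by end_near. Qed.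

End LegendreClosedForm.

(** * Integration over open intervals, which exclude the degenerate angles 0 and pi *)

Section OpenIntervalIntegral.
Variable R : realType.
Implicit Types (f F : R -> R) (a b : R).
Local Notation mu := (@lebesgue_measure R).

Lemma continuous_integrable_oo f a b : continuous f ->
  mu.-integrable `]a, b[ (EFin \o f).
Proof.
move=> cf; apply: (@integrableS _ _ _ mu `[a, b]) => //.
  by apply: subset_itvW.
apply: continuous_compact_integrable; first exact: segment_compact.
exact: continuous_subspaceT.
Qed.

Lemma Rintegral_oo_FTC F f a b : a < b -> continuous f ->
  (forall x, is_derive x (1 : R) F (f x)) ->
  \int[mu]_(x in `]a, b[) f x = F b - F a.
Proof.
move=> ab cf dF.
have If := continuous_compact_integrable (@segment_compact R a b)
  (continuous_subspaceT cf).
have cF : continuous F.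
  move=> x; apply: differentiable_continuous; apply/derivable1_diffP.
  by apply: ex_derive; exact: dF.
have e : \int[mu]_(x in `[a, b]) f x = F b - F a.
  rewrite /Rintegral (@continuous_FTC2 _ f F a b) //.
  - exact: continuous_subspaceT.
  - split.
    + by move=> x _; apply: ex_derive; exact: dF.
    + by apply: cvg_at_right_filter; exact: cF.
    + by apply: cvg_at_left_filter; exact: cF.
  - by move=> x _; rewrite derive1E; apply: derive_val; exact: dF.
rewrite -e Rintegral_itv_bndo_bndc; last first.
  apply: integrableS If => //; exact: subset_itvW.
rewrite Rintegral_itv_obnd_cbnd //.
apply: integrableS If => //; exact: subset_itv_oc_cc.
Qed.

End OpenIntervalIntegral.

(** * Jacobi polynomials integrated against powers of the sine *)

Section JacobiIntegrals.
Variable R : realType.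
Implicit Types (p q v : {poly R}) (t : R).
Local Notation mu := (@lebesgue_measure R).

Definition sin_poly k p t : R := sin t ^+ k * p.[(1 - cos t) / 2].

Definition J k p : R := \int[mu]_(t in `]0, pi[) sin_poly k p t.

Lemma is_derive_haver t :
  is_derive t (1 : R) (fun t : R => (1 - cos t) / 2) (sin t / 2).
Proof. by apply: is_derive_eq; rewrite /GRing.scale /=; field. Qed.

Lemma continuous_sin_poly k p : continuous (sin_poly k p).
Proof.
move=> t; apply: cvgM.
  exact: (continuous_comp (@continuous_sin R t) (@exprn_continuous R _ _)).
have h : {for t, continuous (fun t : R => (1 - cos t) / 2)}.
  apply: cvgM; last exact: cvg_cst.
  by apply: cvgB; [exact: cvg_cst | exact: continuous_cos].
exact: (continuous_comp h (@continuous_horner _ _ _)).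
Qed.

Lemma sin_poly_integrable k p : mu.-integrable `]0, pi[ (EFin \o sin_poly k p).
Proof. by apply: continuous_integrable_oo; exact: continuous_sin_poly. Qed.

Lemma JD k p q : J k (p + q) = J k p + J k q.
Proof.
rewrite /J -RintegralD //; try exact: sin_poly_integrable.
by apply: eq_Rintegral => t _; rewrite /sin_poly hornerD mulrDr.
Qed.

Lemma JZ k c p : J k (c *: p) = c * J k p.
Proof.
rewrite /J -RintegralZl //; last exact: sin_poly_integrable.
by apply: eq_Rintegral => t _; rewrite /sin_poly hornerZ mulrCA.
Qed.

Lemma J_sin2 k p : J k (4 *: (('X - 'X ^+ 2) * p)) = J k.+2 p.
Proof.
apply: eq_Rintegral => t _; rewrite /sin_poly -(addn2 k) exprD sin2cos2.
rewrite !(hornerZ, hornerM, hornerD, hornerN, hornerXn, hornerX).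
by field.
Qed.

(** The integrand is the derivative of sin^(k+1) q(z), which vanishes at 0 and pi; here cos = 1 - 2z
    and sin^2 = 4 z (1 - z). *)
Lemma J_derivative k q :
  J k ((k.+1%:R) *: ((1 - 2 *: 'X) * q) + 2 *: (('X - 'X ^+ 2) * q^`())) = 0.
Proof.
set p := _ + _; suff dF t : is_derive t (1 : R) (sin_poly k.+1 q) (sin_poly k p t).
  rewrite /J (Rintegral_oo_FTC (pi_gt0 R) (@continuous_sin_poly k p) dF).
  by rewrite /sin_poly sinpi sin0 !exprS !mul0r subrr.
have d1 : is_derive t (1 : R) (fun t => sin t ^+ k.+1)
    (k.+1%:R * sin t ^+ k * cos t).
  have -> : (fun t => sin t ^+ k.+1) = (@sin R) ^+ k.+1 by rewrite exprfctE.
  by apply: is_derive_eq; rewrite /GRing.scale /=; ring.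
have d2 := is_derive1_comp (is_derive_poly q _) (is_derive_haver t).
apply: (is_derive_eq (is_deriveM d1 d2)).
rewrite /sin_poly /GRing.scale /p /=.
rewrite !(hornerZ, hornerM, hornerD, hornerN, hornerXn, hornerX, hornerC).
have := sin2cos2 t; set c := cos t; set s := sin t => e.
rewrite exprS [LHS](_ : _ = s ^+ k *
   ((s ^+ 2) / 2 * q^`().[(1 - c) / 2] + k.+1%:R * c * q.[(1 - c) / 2])).
  by rewrite e; field.
by field.
Qed.

(** Integration by parts: by Rodrigues, 2 sin^k [jac n.+1 k] is the derivative of sin^(k+1)
    [jac n k.+2]. *)
Lemma J_jac n k v :
  4 * J k (jac R n.+1 k * v) = - J k.+2 (jac R n k.+2 * v^`()).
Proof.
set e := jac R n k.+2.
have h := J_derivative k (e * v).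
have E : k.+1%:R *: ((1 - 2 *: 'X) * (e * v)) +
    2 *: (('X - 'X ^+ 2) * (e * v)^`()) =
    2 *: (jac R n.+1 k * v) + 2^-1 *: (4 *: (('X - 'X ^+ 2) * (e * v^`()))).
  rewrite jac_rodrigues -/e derivM scalerA.
  have -> : 2^-1 * 4 = 2 :> R by field.
  have {1}-> : k.+1%:R = 2 * (k.+1%:R / 2) :> R by field.
  rewrite -[_ *: ((1 - _) * (e * v))]scalerA -!scalerDr; congr (_ *: _).
  by rewrite -!mul_polyC; ring.
move: h; rewrite E JD (JZ k 2) (JZ k 2^-1) J_sin2.
by move: (J _ _) (J _ _) => x y h; lra.
Qed.

Lemma J_jac_norm n k : J k (jac R n.+1 k * jac R n.+1 k) =
  n.+1%:R * (n.+1 + k)%:R / 4 * J k.+2 (jac R n k.+2 * jac R n k.+2).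
Proof.
have := J_jac n k (jac R n.+1 k).
rewrite deriv_jac -scalerAr JZ.
move: (J _ _) (J _ _) (n.+1%:R) ((n.+1 + k)%:R) => x y a b h.
by apply: (mulfI (_ : 4 != 0)) => //; rewrite h; field.
Qed.

(** For m < n, each integration by parts lowers both degrees by one and raises k by two, until the
    polynomial of lower degree is constant and its derivative is 0. *)
Lemma J_jac_orthogonal n m k : n != m -> J k (jac R n k * jac R m k) = 0.
Proof.
have J0 k' : J k' 0 = 0 by rewrite -(scale0r 0) JZ mul0r.
wlog mn : n m / (m < n)%N => [H nm|_].
  case: (ltngtP m n) => [h|h|h]; first exact: H.
    by rewrite mulrC; apply: H; rewrite // eq_sym.
  by rewrite h eqxx in nm.
elim: n m k mn => [//|n IH] m k mn.
have := J_jac n k (jac R m k).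
case: m mn => [|m] mn.
  by rewrite [in _^`()]jac0 derivC mulr0 J0; move: (J _ _) => x h; lra.
by rewrite deriv_jac -scalerAr JZ IH // mulr0 oppr0; move: (J _ _) => x h; lra.
Qed.

Lemma J0_1 : J 0 1 = pi.
Proof.
have dF (t : R) : is_derive t (1 : R) id (sin_poly 0 1 t).
  by rewrite /sin_poly expr0 mul1r hornerC; exact: is_derive_id.
by rewrite /J (Rintegral_oo_FTC (pi_gt0 R) (@continuous_sin_poly 0 1) dF) subr0.
Qed.

Lemma J1_1 : J 1 1 = 2.
Proof.
have dF (t : R) : is_derive t (1 : R) (fun t => - cos t) (sin_poly 1 1 t).
  by rewrite /sin_poly expr1 hornerC mulr1; apply: is_derive_eq; rewrite opprK.
rewrite /J (Rintegral_oo_FTC (pi_gt0 R) (@continuous_sin_poly 1 1) dF).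
by rewrite cospi cos0; ring.
Qed.

(** Wallis' recursion, from the derivative of sin^(k+1) cos, as 1 - 2z is the cosine. *)
Lemma J_1S k : k.+2%:R * J k.+2 1 = k.+1%:R * J k 1.
Proof.
have := J_derivative k (1 - 2 *: 'X).
set q := 1 - 2 *: 'X.
have -> : k.+1%:R *: (q * q) + 2 *: (('X - 'X ^+ 2) * q^`()) =
   k.+1%:R *: 1 + - (k.+2%:R) *: (4 *: (('X - 'X ^+ 2) * 1)).
  have -> : q^`() = - 2%:P.
    by rewrite /q derivB derivC derivZ derivX alg_polyC sub0r.
  rewrite !scalerA (natrSS R k) (natrS R k) /q -!mul_polyC.
  rewrite !(polyCD, polyCN, polyCM); ring.
rewrite JD (JZ k k.+1%:R) (JZ k (- _)) J_sin2.
by move: (J _ _) (J _ _) (k.+1%:R) (k.+2%:R) => x y a b h; lra.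
Qed.

Lemma J_1_gt0 k : 0 < J k 1.
Proof.
suff : 0 < J k 1 /\ 0 < J k.+1 1 by case.
elim: k => [|k [h1 h2]]; first by rewrite J0_1 J1_1 pi_gt0.
split => //.
have : 0 < k.+2%:R * J k.+2 1 by rewrite J_1S mulr_gt0.
by rewrite pmulr_rgt0.
Qed.

(* By Legendre duplication this is 1 for all k >= 1; that it only depends on the parity
   of k is enough here. *)
Definition kappa k : R :=
  k`!%:R / 2 ^+ k * rgamma (k.+1%:R / 2) ^+ 2 * J k 1.

Lemma kappaSS k : kappa k.+2 = kappa k.
Proof.
have h := J_1S k.
have eJ : J k.+2 1 = k.+1%:R / k.+2%:R * J k 1.
  by rewrite mulrAC -h mulrAC mulfV ?mul1r // pnatr_eq0.
have := rgamma_rec R k 0; rewrite addr0.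
have -> : k.+1%:R / 2 + 1%:R = k.+3%:R / 2 :> R by rewrite (natrSS R k.+1); field.
rewrite /kappa eJ !factS !natrM !exprS => ->.
have h1 : k.+1%:R != 0 :> R by rewrite pnatr_eq0.
have h2 : k.+2%:R != 0 :> R by rewrite pnatr_eq0.
have h3 : 2 ^+ k != 0 :> R by rewrite expf_neq0 // pnatr_eq0.
move: h1 h2 h3; move: (2 ^+ k) (k.+2%:R) (k.+1%:R) => x y z h1 h2 h3.
by field; rewrite h2 h3.
Qed.

Lemma kappa_gt0 k : 0 < kappa k.
Proof.
rewrite /kappa mulr_gt0 ?J_1_gt0 // mulr_gt0 ?divr_gt0 ?ltr0n ?fact_gt0 ?exprn_gt0 //.
by have [] := @rgamma_halves R k.+1.
Qed.

Lemma kappa_le k : kappa k <= kappa 0 + kappa 1.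
Proof.
have h0 := kappa_gt0 0; have h1 := kappa_gt0 1.
suff : kappa k <= kappa 0 + kappa 1 /\ kappa k.+1 <= kappa 0 + kappa 1 by case.
elim: k => [|k [h2 h3]]; first by split; lra.
by rewrite kappaSS.
Qed.

(** Up to [kappa], the inverse of the squared norm of [jac n k] for the weight sin^k;
    [legendre_cst_sq] identifies it with the squared normalising constant of a Legendre factor. *)
Definition jac_wt (n k : nat) : R :=
  (n.*2 + k)%:R * (n + k - 1)`!%:R / (n`!%:R * 2 ^+ k).

(** [J_jac_norm] trades (n + 1, k) for (n, k + 2), which preserves k + 2n; at n = 0 the product is
    [kappa k] by definition. *)
Lemma jac_wt_norm n k : (0 < k)%N ->
  jac_wt n k * J k (jac R n k * jac R n k) = kappa (k + n.*2).
Proof.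
elim: n k => [|n IH] k k0.
  rewrite addn0 /jac_wt /kappa jac0 -polyCM -alg_polyC JZ fact0 mul1r !add0n.
  have -> : k`!%:R = k%:R * (k - 1)`!%:R :> R.
    by case: k k0 => // k _; rewrite factS natrM subn1.
  have h3 : 2 ^+ k != 0 :> R by rewrite expf_neq0 // pnatr_eq0.
  by field.
have -> : (k + n.+1.*2 = k.+2 + n.*2)%N by rewrite doubleS 2!addnS.
rewrite -(IH k.+2 isT) (J_jac_norm n k).
move: (J _ _) => I; rewrite /jac_wt.
have -> : (n.+1.*2 + k = n.*2 + k.+2)%N by rewrite doubleS 2!addnS.
have -> : (n.+1 + k - 1 = n + k)%N by rewrite addSn subn1.
have -> : (n + k.+2 - 1 = (n + k).+1)%N by rewrite 2!addnS subn1.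
rewrite !factS !natrM !exprS addSn.
have h1 := fact_neq0 R n.
have h2 : n.+1%:R != 0 :> R by rewrite pnatr_eq0.
have h3 : 2 ^+ k != 0 :> R by rewrite expf_neq0 // pnatr_eq0.
by move: h3 h2; move: (2 ^+ k) (n.+1%:R) => x y h3 h2; field; rewrite h1 h2 h3.
Qed.

End JacobiIntegrals.

(** * Orthogonality and norms of the Legendre factors *)

Section LegendreOrthogonality.
Variable R : realType.
Implicit Types (L l : int) (t : R).
Local Notation mu := (@lebesgue_measure R).

Lemma pochhammer_nat (N m : nat) :
  pochhammer (N%:R + 1) m * N`!%:R = (N + m)`!%:R :> R.
Proof.
elim: m => [|m IH]; first by rewrite pochhammer0 mul1r addn0.
by rewrite pochhammerSr mulrAC IH addnS factS natrM (natrS R (N + m)) natrD; ring.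
Qed.

Lemma pochhammer_neg_sq (N m : nat) : (m <= N)%N ->
  (pochhammer (- N%:R) m * (N - m)`!%:R) ^+ 2 = N`!%:R ^+ 2 :> R.
Proof.
elim: m => [|m IH] mN; first by rewrite pochhammer0 mul1r subn0.
rewrite -(IH (ltnW mN)) pochhammerSr.
have -> : (N - m = (N - m.+1).+1)%N by rewrite -subSn.
rewrite factS natrM -[X in (_ * (X * _)) ^+ 2]natr1 natrB //; rewrite natrS; ring.
Qed.

(** With n = L - |l| and k = 2|l| + j - 1, the factorials of [legendre_coef] for l >= 0 are (n + k -
    1)! and n!. For l < 0 they change places, and the squared Pochhammer product, ((n + k - 1)! /
    n!)^2, restores the ratio. *)
Lemma legendre_cst_sq j L l : legendre_index j L l ->
  legendre_cst R j L l ^+ 2 =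
  jac_wt R (`|L| - `|l|)%N (`|l|.*2 + j - 1)%N.
Proof.
move=> /and3P[j2]; case: L => [N|N]; last by [].
rewrite -abszE lez_nat /legendre_cst; set m := `|l|%N => mN hl.
set n := (N - m)%N; set k := (m.*2 + j - 1)%N.
have eN : N = (n + m)%N by rewrite subnK.
have ek : k%:R = 2 * m%:R + j%:R - 1 :> R.
  by rewrite /k natrB ?natrD -?muln2 ?natrM ?[_ * 2]mulrC // addn_gt0 (ltnW j2) orbT.
have k0 : (0 < k)%N by rewrite /k subn_gt0 ltn_addl.
have e2 : 2 `^ (- (m%:R + (j%:R - 2) / 2)) ^+ 2 = 2 / 2 ^+ k :> R.
  rewrite -powR_mulrn ?powR_ge0 // -powRrM.
  have -> : - (m%:R + (j%:R - 2) / 2) * 2%:R = 1 - k%:R :> R by rewrite ek; field.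
  by rewrite powRB ?pnatr_eq0 ?implybT // powRr1 // powR_mulrn.
have nf := fact_neq0 R n; have pk : 2 ^+ k != 0 :> R by rewrite expf_neq0 // pnatr_eq0.
have hL : 2 * N%:R + j%:R - 1 = (n.*2 + k)%:R :> R.
  by rewrite natrD ek eN natrD -muln2 natrM; ring.
have hc (a b : nat) : (((2 * N%:R + j%:R - 1) / 2 * (a`!%:R / b`!%:R)) : R) >= 0.
  by rewrite mulr_ge0 ?divr_ge0 // hL.
rewrite !exprMn e2 /legendre_coef sqr_sqrtr -?pmulrn ?hc // hL /jac_wt -/n.
have [l0|l0] := leP 0 l.
- have -> : l = m%:Z by rewrite /m gez0_abs.
  have -> : `|(N%:Z + m%:Z + j%:Z - 2)%R|%N = (n + k - 1)%N.
    by rewrite /n /k; lia.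
  have -> : `|(N%:Z - m%:Z)%R|%N = n by rewrite /n; lia.
  rewrite expr1n; field; rewrite nf pk //.
- have j2' : j = 2 by move: hl; rewrite leNgt l0 => /eqP.
  have -> : l = - m%:Z by rewrite /m ltz0_abs ?opprK.
  have -> : `|(N%:Z - m%:Z + j%:Z - 2)%R|%N = n by rewrite /n; lia.
  have -> : `|(N%:Z - - m%:Z)%R|%N = (N + m)%N by lia.
  have -> : (n + k - 1 = N + m)%N by rewrite /n /k j2'; lia.
  rewrite -/n.
  have h1 := pochhammer_nat N m; have h2 := pochhammer_neg_sq mN; rewrite -/n in h2.
  have Nf := fact_neq0 R N; have NMf := fact_neq0 R (N + m).
  have e3 : pochhammer (- N%:R) m ^+ 2 = N`!%:R ^+ 2 / n`!%:R ^+ 2 :> R.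
    by rewrite -h2 exprMn mulfK // expf_neq0.
  have e4 : pochhammer (N%:R + 1) m = (N + m)`!%:R / N`!%:R :> R.
    by rewrite -h1 mulfK.
  rewrite exprMn e3 e4.
  move: pk nf Nf NMf (n.*2 + k)%:R; move: (2 ^+ k) (n`!%:R) (N`!%:R) ((N + m)`!%:R).
  by move=> a b c x a0 b0 c0 x0 y; field; rewrite a0 b0 c0 x0.
Qed.

Lemma continuous_legendre_ip j L l L' l' : continuous (fun t : R =>
  legendre_fun j L l t * legendre_fun j L' l' t * sin t ^+ (j - 1)).
Proof.
move=> t; apply: cvgM.
  by apply: cvgM; exact: continuous_legendre_fun.
exact: (continuous_comp (@continuous_sin R t) (@exprn_continuous R _ _)).
Qed.

(** The power sin^(j-1) is the part of the surface density that depends on theta_j. When l = l' it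
    joins sin^(2|l|) to form the Jacobi weight sin^k. *)
Definition legendre_ip j L l L' l' : R := \int[mu]_(t in `]0, pi[)
  (legendre_fun j L l t * legendre_fun j L' l' t * sin t ^+ (j - 1)).

Lemma legendre_ip_jac j L L' l : (2 <= j)%N ->
  legendre_ip j L l L' l = legendre_cst R j L l * legendre_cst R j L' l *
    J (`|l|.*2 + j - 1) (jac R (`|L| - `|l|) (`|l|.*2 + j - 1) *
                         jac R (`|L'| - `|l|) (`|l|.*2 + j - 1)).
Proof.
move=> j2; rewrite /J -RintegralZl //; last exact: sin_poly_integrable.
apply: eq_Rintegral => t _; rewrite /legendre_fun /sin_poly hornerM.
rewrite -addnBA ?(ltnW j2) // exprD -addnn exprD; ring.
Qed.

Lemma legendre_norm j L l : legendre_index j L l ->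
  legendre_ip j L l L l = kappa R (`|l|.*2 + j - 1 + (`|L| - `|l|).*2).
Proof.
move=> hL; have /and3P[j2 _ _] := hL.
rewrite legendre_ip_jac // -expr2 legendre_cst_sq // jac_wt_norm //.
by rewrite subn_gt0 ltn_addl.
Qed.

Lemma legendre_orthogonal j L L' l :
  legendre_index j L l -> legendre_index j L' l -> L != L' ->
  legendre_ip j L l L' l = 0.
Proof.
move=> /and3P[j2 hL _] /and3P[_ hL' _] LL'.
rewrite legendre_ip_jac // J_jac_orthogonal ?mulr0 //.
apply: contra LL' => /eqP.
case: L hL => // N hL; case: L' hL' => // N' hL'; rewrite -abszE lez_nat in hL.
rewrite -abszE lez_nat in hL'; rewrite !absz_nat => e.
by rewrite -(subnK hL) e subnK.
Qed.

(* By AM-GM and the normalisation of the diagonal. *)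
Lemma legendre_ip_bound j L l L' l' :
  legendre_index j L l -> legendre_index j L' l' ->
  \int[mu]_(t in `]0, pi[)
    `|legendre_fun j L l t * legendre_fun j L' l' t * sin t ^+ (j - 1)|
  <= kappa R 0 + kappa R 1.
Proof.
move=> hL hL'.
have i1 := continuous_integrable_oo 0 pi (@continuous_legendre_ip j L l L l).
have i2 := continuous_integrable_oo 0 pi (@continuous_legendre_ip j L' l' L' l').
have iD : mu.-integrable `]0, pi[ (EFin \o (fun t : R => 2^-1 *
   (legendre_fun j L l t * legendre_fun j L l t * sin t ^+ (j - 1) +
    legendre_fun j L' l' t * legendre_fun j L' l' t * sin t ^+ (j - 1)))).
  apply: continuous_integrable_oo => t; apply: cvgM; first exact: cvg_cst.
  by apply: cvgD; exact: continuous_legendre_ip.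
apply: (@le_trans _ _ (2^-1 * (legendre_ip j L l L l + legendre_ip j L' l' L' l'))).
  rewrite /legendre_ip -RintegralD // -RintegralZl //; last first.
    apply: continuous_integrable_oo => t.
    by apply: cvgD; exact: continuous_legendre_ip.
  apply: le_Rintegral => //.
    apply: continuous_integrable_oo => t.
    by apply: cvg_norm; exact: continuous_legendre_ip.
  move=> t /=; rewrite in_itv /= => ht.
  have s0 : 0 <= sin t ^+ (j - 1) by rewrite exprn_ge0 // ltW // sin_gt0_pi.
  rewrite normrM (ger0_norm s0) -mulrDl mulrA; apply: ler_wpM2r => //.
  set x := legendre_fun _ _ _ _; set y := legendre_fun _ _ _ _.
  rewrite ler_norml; apply/andP; split.
    have := sqr_ge0 (x + y); nra.
  have := sqr_ge0 (x - y); nra.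
rewrite !legendre_norm //.
have := kappa_le R (`|l|.*2 + j - 1 + (`|L| - `|l|).*2).
have := kappa_le R (`|l'|.*2 + j - 1 + (`|L'| - `|l'|).*2).
by move: (kappa _ _) (kappa _ _) (kappa R 0 + kappa R 1) => a b c; lra.
Qed.

End LegendreOrthogonality.

(** * Termwise integration of a series whose sum is zero almost everywhere *)

Section TermwiseIntegration.
Variable R : realType.
Implicit Types (f h : nat -> R -> R) (T : R).
Local Notation mu := (@lebesgue_measure R).

(** The sum g of the h n is integrable, since the sum of the integrals is finite, and hence finite
    almost everywhere. At such points the partial sums of f tend to 0, and g dominates them
    throughout. *)
Lemma ae_series_integral0 f h T :
  (forall n, continuous (f n)) -> (forall n, continuous (h n)) ->
  (forall n t, `|f n t| <= h n t) ->
  (\sum_(0 <= n <oo) (\int[mu]_(t in `]0, T[) h n t)%:E < +oo)%E ->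
  (forall t, 0 < t < T -> (\sum_(0 <= n <oo) (h n t)%:E < +oo)%E ->
    series (f ^~ t) @ \oo --> 0) ->
  series (fun n => \int[mu]_(t in `]0, T[) f n t) @ \oo --> 0.
Proof.
move=> cf ch fh hfin hz; set D : set R := `]0, T[%classic.
have mD : measurable (D : set (measurableTypeR R)) by exact: measurable_itv.
have h0 n t : 0 <= h n t by apply: le_trans (fh n t).
have ih n := continuous_integrable_oo 0 T (ch n).
have if_ n := continuous_integrable_oo 0 T (cf n).
pose g (t : R) : \bar R := (\sum_(0 <= n <oo) (h n t)%:E)%E.
have g0 t : (0 <= g t)%E by apply: nneseries_ge0 => n _ _; rewrite lee_fin.
have ig : mu.-integrable D g.
  apply/integrableP; split.
    apply: (@ge0_emeasurable_sum _ _ _ D (fun n t => (h n t)%:E) xpredT).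
      by move=> n t _ _; rewrite lee_fin.
    by move=> n _; apply: measurable_int (ih n).
  under eq_integral do rewrite gee0_abs //.
  rewrite integral_nneseries //; last 2 first.
  - by move=> n; apply: measurable_int (ih n).
  - by move=> n t _; rewrite lee_fin.
  move: hfin; congr (_ < _)%E; apply: eq_eseriesr => n _.
  by rewrite /Rintegral fineK //; apply: integrable_fin_num (ih n).
pose F N (t : R) : \bar R := (series (f ^~ t) N)%:E.
have iF N : mu.-integrable D (F N).
  have -> : F N = (fun t => \sum_(0 <= i < N) (f i t)%:E)%E.
    by apply/funext => t; rewrite /F /series /= sumEFin.
  by apply: integrable_sum => // i _; exact: if_.
have aeF : {ae mu, forall x, D x -> F ^~ x @ \oo --> 0%E}.
  have [N [mN N0 sN]] := integrable_ae mD ig.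
  exists N; split => // x nP; apply: sN => fx; apply: nP => Dx.
  apply: cvg_EFin; first by apply: nearW.
  apply: hz; first by move: Dx; rewrite /D /= in_itv.
  by move: (fx Dx); rewrite ge0_fin_numE.
have aeg : {ae mu, forall x N, D x -> (`|F N x| <= g x)%E}.
  apply: aeW => x N Dx; rewrite /F abse_EFin.
  apply: (@le_trans _ _ (\sum_(0 <= i < N) (h i x)%:E)%E).
    rewrite sumEFin lee_fin; apply: le_trans (ler_norm_sum _ _ _) _.
    by apply: ler_sum => i _; exact: fh.
  by apply: nneseries_lim_ge => n _ _; rewrite lee_fin.
have [_ _ dct] := @dominated_convergence _ _ _ mu D mD F (cst 0%E) g
  (fun N => measurable_int mu (iF N)) (measurable_cst _) aeF ig aeg.
have {}dct : (fun N => (\int[mu]_(x in D) F N x)%E) @ \oo --> 0%E.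
  rewrite [X in _ --> X](_ : _ = (\int[mu]_(x in D) (cst 0%E x))%E) //.
  by rewrite integral0.
have -> : series (fun n => \int[mu]_(t in D) f n t) =
    fine \o (fun N => (\int[mu]_(x in D) F N x)%E).
  apply/funext => N; rewrite /= /series /=.
  have -> : F N = (fun t => \sum_(0 <= i < N) (f i t)%:E)%E.
    by apply/funext => t; rewrite /F /series /= sumEFin.
  rewrite integral_sum //=.
  rewrite -[LHS]/(fine (\sum_(0 <= i < N) \int[mu]_(t in D) f i t)%:E) -sumEFin.
  congr fine; apply: eq_bigr => i _; rewrite /Rintegral fineK //.
  exact: integrable_fin_num (if_ i).
exact: (fine_cvg dct).
Qed.

End TermwiseIntegration.

(** * Complex series and their integration over several variables *)

Section ComplexSeries.
Variable R : realType.
Implicit Types (x y z : R[i]) (u b : nat -> R[i]) (f : R -> R[i]).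
Local Notation mu := (@lebesgue_measure R).
Local Notation Re := (@complex.Re R).
Local Notation Im := (@complex.Im R).

(** A submultiplicative norm equivalent to the modulus, for which the integral inequality follows
    separately for real and imaginary parts. *)
Definition nrm1 z : R := `|Re z| + `|Im z|.

Lemma nrm1_ge0 z : 0 <= nrm1 z.
Proof. by rewrite addr_ge0. Qed.

Lemma nrm1M x y : nrm1 (x * y) <= nrm1 x * nrm1 y.
Proof.
case: x y => [a b] [c d]; rewrite /nrm1 /=.
have h1 := ler_normB (a * c) (b * d); have h2 := ler_normD (a * d) (b * c).
rewrite !normrM in h1 h2; lra.
Qed.

Lemma ReM x y : Re (x * y) = Re x * Re y - Im x * Im y.
Proof. by case: x y => [a b] [c d]. Qed.

Lemma ImM x y : Im (x * y) = Re x * Im y + Im x * Re y.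
Proof. by case: x y => [a b] [c d]. Qed.

Definition csum0 u :=
  series (Re \o u) @ \oo --> (0 : R) /\ series (Im \o u) @ \oo --> (0 : R).

Definition abs_summable u := (\sum_(0 <= n <oo) (nrm1 (u n))%:E < +oo)%E.

Lemma csum0Z z u : csum0 u -> csum0 (fun n => z * u n).
Proof.
case=> h1 h2; split.
- have -> : series (Re \o (fun n => z * u n)) = (fun N =>
      Re z * series (Re \o u) N - Im z * series (Im \o u) N).
    apply/funext => N; rewrite /series /= !mulr_sumr -sumrB.
    by apply: eq_bigr => i _; rewrite ReM.
  have -> : 0 = Re z * 0 - Im z * 0 by rewrite !mulr0 subr0.
  by apply: cvgB; apply: cvgM => //; exact: cvg_cst.
- have -> : series (Im \o (fun n => z * u n)) = (fun N =>
      Re z * series (Im \o u) N + Im z * series (Re \o u) N).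
    apply/funext => N; rewrite /series /= !mulr_sumr -big_split /=.
    by apply: eq_bigr => i _; rewrite ImM.
  have -> : 0 = Re z * 0 + Im z * 0 by rewrite !mulr0 addr0.
  by apply: cvgD; apply: cvgM => //; exact: cvg_cst.
Qed.

Definition ccontinuous f := continuous (Re \o f) /\ continuous (Im \o f).

Lemma ccontinuousM f g : ccontinuous f -> ccontinuous g ->
  ccontinuous (fun t => f t * g t).
Proof.
move=> [f1 f2] [g1 g2]; split.
- have -> : Re \o (fun t => f t * g t) =
    fun t => (Re \o f) t * (Re \o g) t - (Im \o f) t * (Im \o g) t.
    by apply/funext => t /=; rewrite ReM.
  by move=> t; apply: cvgB; apply: cvgM; [exact: f1|exact: g1|exact: f2|exact: g2].
- have -> : Im \o (fun t => f t * g t) =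
    fun t => (Re \o f) t * (Im \o g) t + (Im \o f) t * (Re \o g) t.
    by apply/funext => t /=; rewrite ImM.
  by move=> t; apply: cvgD; apply: cvgM; [exact: f1|exact: g2|exact: f2|exact: g1].
Qed.

Lemma ccontinuousZ z f : ccontinuous f -> ccontinuous (fun t => z * f t).
Proof. by apply: ccontinuousM; split => t; exact: cvg_cst. Qed.

Lemma continuous_nrm1 f : ccontinuous f -> continuous (nrm1 \o f).
Proof.
move=> [f1 f2] t; apply: cvgD.
  by apply: cvg_norm; exact: f1.
by apply: cvg_norm; exact: f2.
Qed.

Definition cint T f : R[i] :=
  (\int[mu]_(t in `]0, T[) Re (f t)) +i* (\int[mu]_(t in `]0, T[) Im (f t)).

Lemma cintZ T z f : ccontinuous f -> cint T (fun t => z * f t) = z * cint T f.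
Proof.
move=> [f1 f2].
have i1 := continuous_integrable_oo 0 T f1.
have i2 := continuous_integrable_oo 0 T f2.
have cZ (c : R) (h : R -> R) : continuous h -> mu.-integrable `]0, T[ (EFin \o (fun t => c * h t)).
  move=> ch; apply: continuous_integrable_oo => t.
  by apply: cvgM; [exact: cvg_cst | exact: ch].
apply/eqP; rewrite eq_complex /= ReM ImM /=; apply/andP; split; apply/eqP.
- rewrite -!RintegralZl // -RintegralB //; [|exact: cZ f1|exact: cZ f2].
  by apply: eq_Rintegral => t _; rewrite ReM.
- rewrite -!RintegralZl // -RintegralD //; [|exact: cZ f2|exact: cZ f1].
  by apply: eq_Rintegral => t _; rewrite ImM.
Qed.

Lemma nrm1_cint T f : ccontinuous f ->
  nrm1 (cint T f) <= \int[mu]_(t in `]0, T[) nrm1 (f t).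
Proof.
move=> [f1 f2].
have i1 := continuous_integrable_oo 0 T f1.
have i2 := continuous_integrable_oo 0 T f2.
have n1 : mu.-integrable `]0, T[ (EFin \o (fun t => `|Re (f t)|)).
  by apply: continuous_integrable_oo => t; apply: cvg_norm; exact: f1.
have n2 : mu.-integrable `]0, T[ (EFin \o (fun t => `|Im (f t)|)).
  by apply: continuous_integrable_oo => t; apply: cvg_norm; exact: f2.
rewrite /nrm1 RintegralD //=; apply: lerD.
  exact: le_normr_Rintegral.
exact: le_normr_Rintegral.
Qed.

Lemma abs_summable_le u (v : nat -> R) C : (forall n, nrm1 (u n) <= C * v n) ->
  0 <= C -> (forall n, 0 <= v n) ->
  (\sum_(0 <= n <oo) (v n)%:E < +oo)%E -> abs_summable u.
Proof.
move=> uv C0 v0 vfin.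
apply: (@le_lt_trans _ _ (\sum_(0 <= n <oo) (C%:E * (v n)%:E))%E).
  apply: lee_nneseries => [n _ _|n _]; first by rewrite lee_fin nrm1_ge0.
  by rewrite -EFinM lee_fin.
rewrite nneseriesZl; last by move=> n _; rewrite lee_fin.
by apply: lte_mul_pinfty; rewrite ?lee_fin.
Qed.

(* Integrating out one variable t_m at a time. For almost all values of the last variable
   the series of the b n * G M n t is still absolutely summable, so that the
   induction hypothesis applies to it. *)
Lemma csum0_integral (T : nat -> R) (G : nat -> nat -> R -> R[i]) (B : nat -> R) M b :
  (forall m n, ccontinuous (G m n)) ->
  (forall m n, (m < M)%N -> \int[mu]_(t in `]0, T m[) nrm1 (G m n t) <= B m) ->
  abs_summable b ->
  (forall t : nat -> R, (forall m, (m < M)%N -> 0 < t m < T m) ->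
     csum0 (fun n => b n * \prod_(m < M) G m n (t m))) ->
  csum0 (fun n => b n * \prod_(m < M) cint (T m) (G m n)).
Proof.
move=> cG; elim: M b => [|M IH] b hB sb hz.
  have := hz (fun=> 0) (fun m (h : (m < 0)%N) => False_ind _ (notF h)).
  by congr csum0; apply/funext => n; rewrite !big_ord0.
pose c n := \prod_(m < M) cint (T m) (G m n).
(* The product bounds [c n] uniformly in n. The extra 1 gives 1 <= P, so that [h] also dominates
   [b n * G M n t], the coefficients handed to the induction hypothesis. *)
pose P := 1 + \prod_(m < M) (1 + `|B m|).
have P0 : 0 <= P by rewrite addr_ge0 // prodr_ge0 // => m _; rewrite addr_ge0.
have nprod n (I : seq 'I_M) : nrm1 (\prod_(m <- I) cint (T m) (G m n)) <=
    \prod_(m <- I) (1 + `|B m|).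
  elim: I => [|i I IHI]; first by rewrite !big_nil /nrm1 /= normr1 normr0 addr0.
  rewrite !big_cons; apply: le_trans (nrm1M _ _) _; apply: ler_pM; rewrite ?nrm1_ge0 //.
  apply: le_trans (nrm1_cint _ (cG _ _)) _.
  have := hB i n (ltnW (ltn_ord i : (i < M)%N)); have := ler_norm (B i); lra.
have cP n : nrm1 (c n) <= P.
  by apply: le_trans (nprod n _) _; rewrite /P lerDr.
pose F n t := b n * c n * G M n t.
pose h n t := P * (nrm1 (b n) * nrm1 (G M n t)).
have cF n : ccontinuous (F n) by exact: ccontinuousZ.
have ch n : continuous (h n).
  move=> t; apply: cvgM; first exact: cvg_cst.
  by apply: cvgM; [exact: cvg_cst | exact: continuous_nrm1].
have Fh n t : nrm1 (F n t) <= h n t.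
  apply: le_trans (nrm1M _ _) _; rewrite /h mulrA; apply: ler_wpM2r; first exact: nrm1_ge0.
  apply: le_trans (nrm1M _ _) _; rewrite mulrC; apply: ler_wpM2r => //; exact: nrm1_ge0.
have hfin : (\sum_(0 <= n <oo) (\int[mu]_(t in `]0, T M[) h n t)%:E < +oo)%E.
  apply: (@le_lt_trans _ _ (\sum_(0 <= n <oo) ((P * `|B M|)%:E * (nrm1 (b n))%:E))%E).
    apply: lee_nneseries => [n _ _|n _].
      by rewrite lee_fin Rintegral_ge0 // => t _; rewrite !mulr_ge0 ?nrm1_ge0.
    rewrite -EFinM lee_fin /h.
    have iG : mu.-integrable `]0, T M[ (EFin \o (fun t => nrm1 (G M n t))).
      by apply: continuous_integrable_oo; exact: continuous_nrm1.
    rewrite RintegralZl //; last first.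
      apply: continuous_integrable_oo => t; apply: cvgM; first exact: cvg_cst.
      exact: continuous_nrm1.
    rewrite RintegralZl // -mulrA; apply: ler_wpM2l => //.
    rewrite mulrC; apply: ler_wpM2r; first exact: nrm1_ge0.
    exact: le_trans (hB M n (ltnSn M)) (ler_norm _).
  rewrite nneseriesZl; last by move=> n _; rewrite lee_fin nrm1_ge0.
  by apply: lte_mul_pinfty => //; rewrite lee_fin mulr_ge0.
have hF t : 0 < t < T M -> (\sum_(0 <= n <oo) (h n t)%:E < +oo)%E -> csum0 (F ^~ t).
  move=> ht sh.
  have := IH (fun n => b n * G M n t) _ _ _.
  have -> : F ^~ t = (fun n => b n * G M n t * c n).
    by apply/funext => n; rewrite /F mulrAC.
  apply.
  - by move=> m n mM; apply: hB; exact: ltnW.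
  - apply: (abs_summable_le (C := 1) _ _ _ sh) => // n; last first.
      by rewrite !mulr_ge0 ?nrm1_ge0.
    rewrite mul1r; apply: le_trans (nrm1M _ _) _.
    rewrite /h -[leLHS]mul1r; apply: ler_wpM2r; first by rewrite mulr_ge0 ?nrm1_ge0.
    by rewrite /P lerDl prodr_ge0 // => m _; rewrite addr_ge0.
  - move=> s hs; pose s' m := if m == M then t else s m.
    have -> : (fun n => b n * G M n t * \prod_(m < M) G m n (s m)) =
        (fun n => b n * \prod_(m < M.+1) G m n (s' m)).
      apply/funext => n; rewrite big_ord_recr /= /s' eqxx -mulrA.
      rewrite [X in _ = _ * X]mulrC; congr (_ * (_ * _)).
      by apply: eq_bigr => m _; rewrite ltn_eqF.
    apply: hz => m mM; rewrite /s'; case: eqP => [->//|/eqP mM'].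
    by apply: hs; rewrite ltn_neqAle mM'.
have -> : (fun n => b n * \prod_(m < M.+1) cint (T m) (G m n)) =
    (fun n => cint (T M) (F n)).
  by apply/funext => n; rewrite big_ord_recr /= cintZ // mulrA.
split.
- apply: (ae_series_integral0 (f := fun n t => Re (F n t)) (h := h)) => //.
  + by move=> n; exact: (cF n).1.
  + by move=> n t; apply: le_trans (Fh n t); rewrite lerDl.
  + by move=> t ht sh; have [] := hF t ht sh.
- apply: (ae_series_integral0 (f := fun n t => Im (F n t)) (h := h)) => //.
  + by move=> n; exact: (cF n).2.
  + by move=> n t; apply: le_trans (Fh n t); rewrite lerDr.
  + by move=> t ht sh; have [] := hF t ht sh.
Qed.

End ComplexSeries.

(** * Polar coordinates: injectivity away from the poles, and surjectivity *)

Section PolarCoordinates.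
Variable R : realType.
Implicit Types (th x : nat -> R) (k i m : nat).

(* The coordinates of [polar], as functions of a sequence of angles, for the
   sphere in dimension k. *)
Definition polar_coord th k i : R :=
  match i with
  | 0 => (\prod_(2 <= m < k) sin (th m)) * cos (th 1)
  | 1 => (\prod_(2 <= m < k) sin (th m)) * sin (th 1)
  | i => (\prod_(i.+1 <= m < k) sin (th m)) * cos (th i)
  end.

Lemma polar_coordS th k i : (2 <= k)%N -> (i < k)%N ->
  polar_coord th k.+1 i = polar_coord th k i * sin (th k).
Proof.
move=> k2 ik; case: i ik => [|[|i]] ik /=;
  by rewrite big_nat_recr //= mulrAC.
Qed.

Lemma polar_coord_last th k : (2 <= k)%N -> polar_coord th k.+1 k = cos (th k).
Proof. by case: k => [|[|k]] // _; rewrite /= big_geq // mul1r. Qed.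

Lemma eq_polar_coord th th' k : (2 <= k)%N ->
  (forall m, (1 <= m < k)%N -> th m = th' m) ->
  forall i, (i < k)%N -> polar_coord th k i = polar_coord th' k i.
Proof.
move=> k2 eth.
have ep p : (1 <= p)%N ->
    \prod_(p <= m < k) sin (th m) = \prod_(p <= m < k) sin (th' m).
  move=> p1; apply: eq_big_nat => m /andP[pm mk].
  by rewrite eth // mk (leq_trans p1).
move=> [|[|i]] ik /=; rewrite ep // eth //.
Qed.

Lemma polar_coord_sumsq th k : (2 <= k)%N ->
  \sum_(i < k) polar_coord th k i ^+ 2 = 1.
Proof.
elim: k => // k IH; rewrite leq_eqVlt ltnS => /orP[/eqP <-|k2].
  by rewrite !big_ord_recr big_ord0 /= big_geq // !mul1r add0r cos2Dsin2.
rewrite big_ord_recr /= polar_coord_last //.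
under eq_bigr => i _ do rewrite polar_coordS // exprMn.
by rewrite -mulr_suml IH // mul1r addrC cos2Dsin2.
Qed.

(** The last coordinate gives the last angle, as cos is injective on [0, pi]; division by its
    nonzero sine leads to the sphere one dimension lower. Of theta_1 just the point on the circle is
    recovered. *)
Lemma polar_coord_inj th th' k : (2 <= k)%N ->
  (forall m, (2 <= m < k)%N -> 0 < th m < pi) ->
  (forall m, (2 <= m < k)%N -> 0 <= th' m <= pi) ->
  (forall i, (i < k)%N -> polar_coord th k i = polar_coord th' k i) ->
  [/\ cos (th 1) = cos (th' 1), sin (th 1) = sin (th' 1) &
     forall m, (2 <= m < k)%N -> th m = th' m].
Proof.
elim: k => // k IH; rewrite leq_eqVlt ltnS => /orP[/eqP <- _ _ h|k2 hth hth' h].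
  have := h 0%N isT; have := h 1%N isT; rewrite /= !big_geq // !mul1r => -> ->.
  by split => // m /andP[h1 h2]; move: (leq_ltn_trans h1 h2); rewrite ltnn.
have ek : th k = th' k.
  have := h k (ltnSn k); rewrite !polar_coord_last //; apply: cos_inj.
    by rewrite in_itv /=; have /andP[a b] := hth k (introT andP (conj k2 (ltnSn k)));
       rewrite !ltW.
  by rewrite in_itv /=; apply: hth'; rewrite k2 ltnSn.
have sk : sin (th k) != 0.
  by rewrite gt_eqF // sin_gt0_pi // hth // k2 ltnSn.
have [] := IH k2 _ _ _.
- by move=> m /andP[m2 mk]; apply: hth; rewrite m2 leqW.
- by move=> m /andP[m2 mk]; apply: hth'; rewrite m2 leqW.
- move=> i ik; apply: (mulIf sk); rewrite -polar_coordS // h ?(leqW ik) //.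
  by rewrite polar_coordS // ek.
move=> -> -> h'; split => // m /andP[m2]; rewrite ltnS leq_eqVlt.
by case/orP=> [/eqP ->//|mk]; apply: h'; rewrite m2.
Qed.

Lemma polar_coord_degenerate th k m : (2 <= m < k)%N -> sin (th m) = 0 ->
  polar_coord th k 0 = 0 /\ polar_coord th k 1 = 0.
Proof.
move=> hm sm /=.
have -> : \prod_(2 <= m < k) sin (th m) = 0.
  apply/eqP; rewrite prodf_seq_eq0; apply/hasP; exists m.
    by rewrite mem_index_iota.
  by rewrite sm eqxx.
by rewrite !mul0r.
Qed.

Lemma circle_angle (r a b : R) : 0 <= r -> r ^+ 2 = a ^+ 2 + b ^+ 2 ->
  exists2 t, 0 <= t < 2 * pi & a = r * cos t /\ b = r * sin t.
Proof.
move=> r0 e; have pi0 := pi_gt0 R.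
have [r00|rn0] := eqVneq r 0.
  exists 0; first by rewrite lexx mulr_gt0.
  move: e; rewrite r00 expr0n /= => /esym/eqP.
  by rewrite paddr_eq0 ?sqr_ge0 // !sqrf_eq0 !mul0r => /andP[/eqP -> /eqP ->].
have rp : 0 < r by rewrite lt_neqAle eq_sym rn0.
set c := a / r; have ea : a = r * c by rewrite /c mulrC divfK.
set s := b / r; have eb : b = r * s by rewrite /s mulrC divfK.
have cs : c ^+ 2 + s ^+ 2 = 1.
  have r2 : r ^+ 2 != 0 by rewrite expf_neq0.
  by apply: (mulfI r2); rewrite mulr1 {2}e ea eb; ring.
have hc : -1 <= c <= 1.
  rewrite -ler_norml -(@expr_le1 _ 2%N) // real_normK ?num_real //.
  by have := sqr_ge0 s; lra.
have ec : cos (acos c) = c by apply: acosK; rewrite in_itv.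
have es : sin (acos c) = `|s|.
  by rewrite sin_acos // -sqrtr_sqr; congr Num.sqrt; lra.
have a0 := acos_ge0 hc; have a1 := acos_lepi hc.
have [s0|s0] := leP 0 s.
  exists (acos c); last by rewrite ec es ger0_norm.
  by rewrite a0 /=; lra.
have an0 : acos c != 0.
  by apply/eqP => h; move: es; rewrite h sin0 => /esym/eqP; rewrite normr_eq0 lt_eqF.
have ap : 0 < acos c by rewrite lt_neqAle eq_sym an0.
(* Lower half plane: s < 0 makes acos c positive, so the angle stays below 2 pi. *)
exists (2 * pi - acos c); first by apply/andP; split; lra.
have -> : 2 * pi = pi *+ 2 :> R by rewrite mulr_natl.
rewrite cosB sinB cos2pi sin2pi !mul0r !mul1r addr0 sub0r ec es ltr0_norm //.
by rewrite opprK.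
Qed.

(** The radius is arbitrary, possibly 0, because the induction passes to the remaining coordinates,
    which lie on a sphere of radius r sin(acos c). *)
Lemma polar_coord_surj k x (r : R) : (2 <= k)%N -> 0 <= r ->
  r ^+ 2 = \sum_(i < k) x i ^+ 2 ->
  exists th, [/\ 0 <= th 1 < 2 * pi,
    forall m, (2 <= m < k)%N -> 0 <= th m <= pi &
    forall i, (i < k)%N -> x i = r * polar_coord th k i].
Proof.
elim: k r => // k IH r; rewrite leq_eqVlt ltnS => /orP[/eqP <- r0|k2 r0].
  rewrite !big_ord_recr big_ord0 /= add0r => e.
  have [t ht [h0 h1]] := circle_angle r0 e.
  exists (fun=> t); split => // [m /andP[m2 m2']|[|[|i]]] //.
  - by move: (leq_ltn_trans m2 m2'); rewrite ltnn.
  - by move=> _ /=; rewrite big_geq // mul1r.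
  - by move=> _ /=; rewrite big_geq // mul1r.
rewrite big_ord_recr /= => e.
have sk0 : 0 <= \sum_(i < k) x i ^+ 2 by apply: sumr_ge0 => i _; exact: sqr_ge0.
(* For r = 0 this is 0 by the convention on division, still a cosine, and x k is 0 as well. *)
set c := x k / r.
have xk : x k = r * c.
  have [r00|rn0] := eqVneq r 0; last by rewrite /c mulrC divfK.
  move: e; rewrite r00 expr0n /= mul0r => /esym/eqP.
  by rewrite paddr_eq0 ?sqr_ge0 // sqrf_eq0 => /andP[_ /eqP].
have hc : -1 <= c <= 1.
  have [r00|rn0] := eqVneq r 0.
    by rewrite /c r00 invr0 mulr0; lra.
  have rp : 0 < r ^+ 2 by rewrite exprn_even_gt0.
  rewrite -ler_norml -(@expr_le1 _ 2%N) // real_normK ?num_real //.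
  rewrite -(ler_pM2l rp) mulr1 -exprMn -xk; lra.
have ec : cos (acos c) = c by apply: acosK; rewrite in_itv.
have s0 : 0 <= sin (acos c) by rewrite sin_acos // sqrtr_ge0.
have er : (r * sin (acos c)) ^+ 2 = \sum_(i < k) x i ^+ 2.
  by rewrite exprMn sin2cos2 ec mulrBr mulr1 -exprMn -xk e addrK.
have [th [h1 h2 h3]] := IH (r * sin (acos c)) k2 (mulr_ge0 r0 s0) er.
pose th' m := if m == k then acos c else th m.
have eth m : (1 <= m < k)%N -> th' m = th m.
  by move=> /andP[_ mk]; rewrite /th' ltn_eqF.
exists th'; split.
- by rewrite eth.
- move=> m /andP[m2]; rewrite ltnS leq_eqVlt => /orP[/eqP ->|mk].
    by rewrite /th' eqxx acos_ge0 // acos_lepi.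
  by rewrite eth ?h2 ?m2 // (ltnW m2).
- move=> i; rewrite ltnS leq_eqVlt => /orP[/eqP ->|ik].
    by rewrite polar_coord_last // /th' eqxx ec.
  rewrite polar_coordS // (eq_polar_coord k2 eth) // h3 // /th' eqxx; ring.
Qed.

End PolarCoordinates.

(** * Spherical harmonics on the sphere and their behaviour under rotation *)

Section HarmonicsGeometry.
Variables (R : realType) (d : nat).
Hypothesis d2 : (2 <= d)%N.
Implicit Types (L : Iset d) (th : (d.-1).-tuple R) (x : 'rV[R]_d).

Lemma polarE th (i : 'I_d) : polar th 0 i = polar_coord (entry th) d i.
Proof. by rewrite mxE; case: i => [[|[|i]] hi]. Qed.

Definition angle_tuple (f : nat -> R) : (d.-1).-tuple R :=
  [tuple f i.+1 | i < d.-1].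

Lemma entry_angle_tuple f j : (0 < j < d)%N -> entry (angle_tuple f) j = f j.
Proof.
case: j => // j /= jd; have jd' : (j < d.-1)%N by case: d d2 jd => [|[]].
exact: (nth_mktuple (fun i : 'I_ _ => f i.+1) 0 (Ordinal jd')).
Qed.

Lemma polar_unit_sphere th : unit_sphere (polar th).
Proof.
rewrite /unit_sphere /=; under eq_bigr do rewrite polarE.
exact: polar_coord_sumsq.
Qed.

Lemma polar_angles x : unit_sphere x ->
  angle_domain (angles x) /\ polar (angles x) = x.
Proof.
move=> hx; apply: (@xgetPex _ _ [set th | angle_domain th /\ polar th = x]).
pose y i := if insub i is Some j then x 0 j else 0.
have yE (i : 'I_d) : y i = x 0 i by rewrite /y valK.
have hy : 1 ^+ 2 = \sum_(i < d) y i ^+ 2.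
  by rewrite expr1n -[LHS]hx; apply: eq_bigr => i _; rewrite yE.
have [th [h1 h2 h3]] := polar_coord_surj d2 ler01 hy.
exists (angle_tuple th); split.
  split; first by rewrite entry_angle_tuple.
  by move=> j /andP[j2 jd]; rewrite entry_angle_tuple ?jd ?(ltnW j2) // h2 ?j2.
apply/rowP => i; rewrite polarE -yE h3 // mul1r.
by apply: eq_polar_coord => // m hm; rewrite entry_angle_tuple.
Qed.

Lemma expiD (s t : R) : expi (s + t) = expi s * expi t.
Proof. by rewrite /expi cosD sinD; apply/eqP; rewrite eq_complex /= eqxx addrC eqxx. Qed.

Lemma expi0 : expi (0 : R) = 1.
Proof. by rewrite /expi cos0 sin0. Qed.

Lemma expi_nat (n : nat) (t : R) : expi (n%:R * t) = expi t ^+ n.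
Proof.
elim: n => [|n IH]; first by rewrite mul0r expr0 expi0.
by rewrite natrS mulrDl mul1r expiD IH exprSr.
Qed.

(** By de Moivre. It makes harmonics insensitive to the choice of theta_1 modulo 2 pi: theta_1 +
    alpha may leave [0, 2 pi), whereas [angles] always returns a value inside it. *)
Lemma eq_expi_int (l : int) (s t : R) :
  cos s = cos t -> sin s = sin t -> expi (l%:~R * s) = expi (l%:~R * t).
Proof.
move=> ec es; case: l => n; first by rewrite -!pmulrn !expi_nat /expi ec es.
rewrite NegzE mulrNz -pmulrn !mulNr -!mulrN !expi_nat /expi.
by rewrite !cosN !sinN ec es.
Qed.

Lemma Iset_path L j : (2 <= j < d)%N ->
  `|entry (val L) 1| <= entry (val L) j /\
  legendre_index j (entry (val L) j) (entry (val L) j.-1).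
Proof.
have := valP L; rewrite /in_Iset => /(pathP 0); rewrite size_behead size_tuple => hp.
have step i : (i.+2 < d)%N -> nth 0 (`|entry (val L) 1| :: behead (val L)) i <=
    entry (val L) i.+2.
  move=> hi; have hi' : (i < d.-1.-1)%N by case: d hi => [|[|[]]].
  by have := hp i hi'; rewrite nth_behead.
have l1 i : (i.+2 < d)%N -> `|entry (val L) 1| <= entry (val L) i.+2.
  elim: i => [|i IH] hi; first exact: (step 0%N).
  apply: le_trans (IH (ltnW hi)) _; apply: le_trans (step i.+1 hi).
  by rewrite /= nth_behead.
case: j => [|[|j]] // /andP[_ hj]; split; first exact: l1.
rewrite /legendre_index /=; case: j hj => [|j] hj.
  by rewrite orbT andbT; exact: l1.
have h0 : 0 <= entry (val L) j.+2 by apply: le_trans (l1 j (ltnW hj)).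
rewrite h0 andbT ger0_norm //; apply: le_trans (step j.+1 hj).
by rewrite /= nth_behead.
Qed.

Lemma sph_harmonic_polar_angles L th :
  (forall j, (2 <= j < d)%N -> 0 < entry th j < pi) ->
  sph_harmonic L (polar th) = sph_harmonic_polar L th.
Proof.
move=> hth; rewrite /sph_harmonic.
have [[_ dom] e] := polar_angles (polar_unit_sphere th).
have [ec es ej] := @polar_coord_inj R (entry th) (entry (angles (polar th))) d d2
  hth dom (fun i (id : (i < d)%N) => etrans (esym (polarE th (Ordinal id)))
    (etrans (congr1 (fun x : 'rV__ => x 0 (Ordinal id)) (esym e)) (polarE _ (Ordinal id)))).
rewrite /sph_harmonic_polar (eq_expi_int _ ec es); congr (_ * _ * _).
by apply: eq_big_nat => j hj; rewrite ej.
Qed.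

(** Clear when no sin theta_j vanishes. Otherwise the first two coordinates of x are 0 and the
    rotation fixes x. Then either l_1 = 0 and the phase is 1, or Y_L vanishes at x: its factor of
    index j contains sin^|l_(j-1)| with |l_(j-1)| >= |l_1| > 0. *)
Lemma sph_harmonic_rotation L x (alpha : R) : unit_sphere x ->
  sph_harmonic L (x *m rotation d alpha) =
  expi ((entry (val L) 1)%:~R * alpha) * sph_harmonic L x.
Proof.
move=> hx; have [[dom1 dom] e] := polar_angles hx.
set th := angles x in dom1 dom e.
pose th' := angle_tuple (fun j => if j == 1%N then entry th 1 + alpha else entry th j).
have e1 : entry th' 1 = entry th 1 + alpha by rewrite entry_angle_tuple.
have ej j : (2 <= j < d)%N -> entry th' j = entry th j.
  by move=> /andP[j2 jd]; rewrite entry_angle_tuple ?jd ?(ltnW j2) // gtn_eqF.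
have er := polar_rotation d2 e1 ej; rewrite e in er.
have [hs|] := boolP [forall j : 'I_d, (2 <= j)%N ==> (sin (entry th j) != 0)].
  have hth j : (2 <= j < d)%N -> 0 < entry th j < pi.
    move=> /andP[j2 jd]; have := dom j (introT andP (conj j2 jd)).
    have := forallP hs (Ordinal jd); rewrite /= j2 /= => sj /andP[a b].
    rewrite !lt_neqAle a b !andbT; apply/andP; split.
      by apply: contraNneq sj => <-; rewrite sin0.
    by apply: contraNneq sj => ->; rewrite sinpi.
  rewrite -er -[in RHS]e !sph_harmonic_polar_angles //; last first.
    by move=> j hj; rewrite ej // hth.
  rewrite /sph_harmonic_polar e1.
  rewrite (mulrDr _ (entry th 1)) expiD.
  rewrite (@eq_big_nat _ _ _ 2 d _ (fun j => (legendre_tilde j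
      (entry (val L) j) (entry (val L) j.-1) (entry th j))%:C)); last first.
    by move=> j hj; rewrite ej.
  by ring.
rewrite negb_forall => /existsP[j]; rewrite negb_imply negbK => /andP[j2 /eqP sj].
have hj : (2 <= j < d)%N by rewrite j2 ltn_ord.
have -> : x *m rotation d alpha = x.
  have [z0 z1] := polar_coord_degenerate hj sj.
  have [z0' z1'] : polar_coord (entry th') d 0 = 0 /\ polar_coord (entry th') d 1 = 0.
    by apply: (polar_coord_degenerate hj); rewrite ej.
  rewrite -er -[RHS]e; apply/rowP => i; rewrite !polarE.
  case: i => [[|[|i]] hi]; [exact: etrans z0' (esym z0)|exact: etrans z1' (esym z1)|].
  rewrite /polar_coord [nat_of_ord _]/= (ej i.+2) //; congr (_ * _).
  by apply: eq_big_nat => m /andP[im md]; rewrite ej // md (leq_trans _ im).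
have [l0|l0] := eqVneq (entry (val L) 1) 0; first by rewrite l0 mul0r expi0 mul1r.
suff -> : sph_harmonic L x = 0 by rewrite mulr0.
rewrite /sph_harmonic /sph_harmonic_polar -/th.
rewrite (_ : \prod_(2 <= m < d) _ = 0) ?mulr0 //.
apply/eqP; rewrite prodf_seq_eq0; apply/hasP; exists (nat_of_ord j).
  by rewrite mem_index_iota.
have [_ hjL] := Iset_path L hj.
rewrite /= legendre_tildeE ?dom // /legendre_fun sj expr0n.
have -> : (`|entry (val L) j.-1|%N == 0%N) = false.
  apply/negbTE; rewrite absz_eq0; move: (j : nat) hj => [|[|[|m]]] // hm.
  have [h _] := @Iset_path L m.+2 (ltnW hm).
  by apply: contraNneq l0 => e0; move: h; rewrite /= e0 normr_le0.
by rewrite mulr0 mul0r.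
Qed.

End HarmonicsGeometry.

(** * Unconditional sums as series along an enumeration *)

Section EnumeratedSums.
Variables (R : realType) (I : countType).
Implicit Types (f : I -> R[i]) (s : R[i]).
Local Notation Re := (@complex.Re R).
Local Notation Im := (@complex.Im R).

#[local] Existing Instance summability.totally_filter.

(** The family in the order of the codes given by [pickle]; numbers that are not codes contribute
    0. *)
Definition enumerate (V : nmodType) (f : I -> V) (n : nat) : V :=
  oapp f 0 (@pickle_inv I n).

Definition initial_fset (n : nat) : {fset I} :=
  [fset x in pmap (@pickle_inv I) (iota 0 n)]%fset.

Lemma mem_initial_fset n x : (x \in initial_fset n) = (choice.pickle x < n)%N.
Proof.
rewrite !inE mem_pmap; apply/mapP/idP => [[m]|xn].
  by rewrite mem_iota => /andP[_ mn] e; have := @pickle_invK I m; rewrite -e /= => ->.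
by exists (choice.pickle x); rewrite ?mem_iota ?pickleK_inv.
Qed.

Lemma sum_initial_fset (V : nmodType) (f : I -> V) n :
  \sum_(x <- initial_fset n) f x = \sum_(0 <= i < n) enumerate f i.
Proof.
pose l := pmap (@pickle_inv I) (iota 0 n).
have ul : uniq l.
  by apply: (pmap_uniq (@pickle_invK I)); exact: iota_uniq.
rewrite (perm_big l) /=; last first.
  by apply: uniq_perm => [||x]; rewrite ?fset_uniq // !inE.
rewrite /l /index_iota subn0; elim: (iota 0 n) => [|i r IH].
  by rewrite !big_nil.
rewrite big_cons /= /enumerate -IH; case: (@pickle_inv I i) => [x|] /=.
  by rewrite big_cons.
by rewrite add0r.
Qed.

Lemma abs_Re_le_cmod (z : R[i]) : `|Re z| <= cmod z.
Proof.
case: z => a b; rewrite /cmod /= -[leLHS]sqrtr_sqr ler_sqrt ?lerDl ?sqr_ge0 //.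
by rewrite addr_ge0 // sqr_ge0.
Qed.

Lemma abs_Im_le_cmod (z : R[i]) : `|Im z| <= cmod z.
Proof.
case: z => a b; rewrite /cmod /= -[leLHS]sqrtr_sqr ler_sqrt ?lerDr ?sqr_ge0 //.
by rewrite addr_ge0 // sqr_ge0.
Qed.

Lemma cmod_ge0 (z : R[i]) : 0 <= cmod z.
Proof. exact: le_trans (normr_ge0 _) (abs_Re_le_cmod z). Qed.

Lemma has_sum_enumerate f s : has_sum f s ->
  cmod (\sum_(0 <= i < n) enumerate f i - s) @[n --> \oo] --> (0 : R).
Proof.
move=> hf; apply/cvgrPdist_lt => e e0.
move/cvgrPdist_lt: hf => /(_ e e0)[J _ hJ].
(* From this n on, the elements with code below n include the whole finite set J. *)
exists (\max_(x : J) choice.pickle (val x)).+1 => // n /= hn.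
rewrite -sum_initial_fset big_seq_fsetE /=; apply: (hJ (initial_fset n)).
rewrite /mkset; apply/fsubsetP => x xJ; rewrite mem_initial_fset.
by apply: leq_trans hn; rewrite ltnS (leq_bigmax [` xJ]%fset).
Qed.

Lemma has_sum_unique f s s' : has_sum f s -> has_sum f s' -> s = s'.
Proof.
move=> /has_sum_enumerate h /has_sum_enumerate h'.
have cD (x y : R[i]) : cmod (x - y) <= cmod x + cmod y.
  have cN z : cmod (- z) = cmod z by case: z => a b; rewrite /cmod /= !sqrrN.
  by rewrite -[cmod y]cN; exact: (@le_normcD R x (- y)).
apply/eqP; rewrite -subr_eq0; apply/eqP/ComplexField.Normc.eq0_normc/eqP.
rewrite eq_le cmod_ge0 andbT; apply/ler_addgt0Pl => e e0; rewrite addr0.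
move/cvgrPdist_lt: h => /(_ _ (divr_gt0 e0 (ltr0Sn R 1)))[N _ hN].
move/cvgrPdist_lt: h' => /(_ _ (divr_gt0 e0 (ltr0Sn R 1)))[N' _ hN'].
have := hN (maxn N N') (leq_maxl _ _); have := hN' (maxn N N') (leq_maxr _ _).
rewrite /= !sub0r !normrN !ger0_norm ?cmod_ge0 //.
set S := \sum_(0 <= i < _) _ => h1 h2.
have -> : s - s' = (S - s') - (S - s) by ring.
apply: le_trans (cD _ _) _.
by apply: ltW; rewrite [ltRHS]splitr; apply: ltrD.
Qed.

Lemma csum0_has_sum_sub f g s : has_sum f s -> has_sum g s ->
  csum0 (enumerate (fun p => f p - g p)).
Proof.
move=> /has_sum_enumerate h /has_sum_enumerate h'.
(* P stands for the real or the imaginary part. *)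
have key (P : R[i] -> R) : (forall z, `|P z| <= cmod z) ->
    (forall x y, P (x + y) = P x + P y) -> (forall x y, P (x - y) = P x - P y) ->
    P 0 = 0 ->
    series (P \o enumerate (fun p => f p - g p)) @ \oo --> 0.
  move=> hP PD PB P0.
  have lim0 u : (forall n : nat, `|u n| <= cmod (\sum_(0 <= i < n) enumerate f i - s) +
      cmod (\sum_(0 <= i < n) enumerate g i - s)) -> u @ \oo --> (0 : R).
    move=> hu; apply/norm_cvg0P.
    have hs : cmod (\sum_(0 <= i < n) enumerate f i - s) +
       cmod (\sum_(0 <= i < n) enumerate g i - s) @[n --> \oo] --> (0 : R).
      by rewrite -[X in _ --> X]addr0; apply: cvgD.
    apply: (squeeze_cvgr _ (cvg_cst 0) hs).
    by apply: nearW => n; rewrite normr_ge0 hu.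
  apply: lim0 => n.
  have -> : series (P \o enumerate (fun p => f p - g p)) n =
      P (\sum_(0 <= i < n) enumerate f i - s) - P (\sum_(0 <= i < n) enumerate g i - s).
    rewrite !PB opprB addrA subrK -PB -sumrB /series /=.
    rewrite (big_morph P PD P0); apply: eq_bigr => i _ /=; congr P.
    by rewrite /enumerate; case: pickle_inv => [p|] /=; rewrite ?subrr.
  by apply: le_trans (ler_normB _ _) _; apply: lerD; exact: hP.
split; apply: key => //;
  first [exact: abs_Re_le_cmod | exact: abs_Im_le_cmod | by move=> [a b] [c e]].
Qed.

Lemma abs_summable_enumerate f (w : I -> R) (C : R) :
  (forall p, nrm1 (f p) <= C * w p) -> 0 <= C -> (forall p, 0 <= w p) ->
  (\esum_(p in [set: I]) (w p)%:E < +oo)%E -> abs_summable (enumerate f).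
Proof.
move=> fw C0 w0 wfin.
have ew0 n : 0 <= enumerate w n by rewrite /enumerate; case: pickle_inv => //=.
apply: (abs_summable_le (C := C) (v := enumerate w)) => // [n|].
  rewrite /enumerate; case: pickle_inv => [p|] //=.
  by rewrite /nrm1 /= normr0 addr0 mulr0.
apply: le_lt_trans wfin.
rewrite nneseries_esumT; last by move=> n; rewrite lee_fin.
have -> : \esum_(p in [set: I]) (w p)%:E =
    \esum_(n in range (@choice.pickle I)) (enumerate w n)%:E.
  rewrite (@reindex_esum _ _ _ [set: I] _ (@choice.pickle I)).
    by apply: eq_esum => p _; rewrite /enumerate pickleK_inv.
  split; [by move=> p _; exists p|move=> p q _ _ e|by move=> _ [p _ <-]; exists p].
  by apply: (pcan_inj (@choice.pickleK I)).
rewrite [leRHS]esum_mkcond; apply: le_esum => n _.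
case: ifPn => // /negP hn; rewrite lee_fin /enumerate.
case e : (pickle_inv n) => [p|] //=; exfalso; apply: hn; apply/mem_set.
by exists p => //; have := @pickle_invK I n; rewrite e.
Qed.

End EnumeratedSums.

(** * Lower bounds for the summability weights *)

Section Weights.
Variables (R : realType) (d : nat).
Hypothesis d2 : (2 <= d)%N.

(** For j >= 1, (j + d - 2)! lies between denominator and numerator: it is a binomial coefficient
    times j! (d-2)!, and also (j + d - 2) times (j + d - 3)!. *)
Lemma dim_harmonics_ge1 j : 1 <= dim_harmonics R d j.
Proof.
rewrite /dim_harmonics; case: eqP => // /eqP j0.
rewrite ler_pdivlMr ?ltr0n ?muln_gt0 ?fact_gt0 // mul1r ler_nat.
case: d d2 => [|[|e]] // _; rewrite !subSS subn0.
case: j j0 => [|j] // _.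
have -> : (2 * j.+1 + e.+2 - 2 = 2 * j.+1 + e)%N by lia.
have -> : (j.+1 + e.+2 - 3 = j + e)%N by lia.
apply: (@leq_trans (j.+1 + e)`!); last by rewrite addSn factS leq_mul2r; apply/orP; right; lia.
have := @bin_fact (j.+1 + e) j.+1 (leq_addr _ _).
rewrite addKn => <-; rewrite leq_pmull // bin_gt0 leq_addr //.
Qed.

Lemma sphere_area_gt0 : 0 < sphere_area R d.
Proof.
rewrite /sphere_area !mulr_gt0 ?powR_gt0 ?pi_gt0 //.
by have [] := @rgamma_halves R d (ltnW d2).
Qed.

Lemma nrm1_le_cmod (z : R[i]) : nrm1 z <= 2 * cmod z.
Proof.
by have := abs_Re_le_cmod z; have := abs_Im_le_cmod z; rewrite /nrm1; lra.
Qed.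

End Weights.

Lemma Rintegral_oo_cst (R : realType) (a b c : R) : a < b ->
  \int[@lebesgue_measure R]_(t in `]a, b[) c = c * (b - a).
Proof.
move=> ab; have dF (t : R) : is_derive t (1 : R) (fun t => c * t) c.
  by apply: is_derive_eq; rewrite /GRing.scale /=; ring.
have cc : continuous (fun _ : R => c) by move=> t; exact: cvg_cst.
by rewrite (Rintegral_oo_FTC ab cc dF) mulrBr.
Qed.

(** * Products of two harmonics, angle by angle *)

Section TestFunctions.
Variables (R : realType) (d : nat).
Hypothesis d2 : (2 <= d)%N.
Implicit Types (L Q : Iset d) (m : nat) (t : R).
Local Notation Re := (@complex.Re R).
Local Notation Im := (@complex.Im R).
Local Notation mu := (@lebesgue_measure R).
Local Notation ell L j := (entry (val L) j).

(* The factor of Y_L * conj Y_Q depending on the angle theta_(m+1), times the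
   density sin theta_(m+1) ^ m of the surface measure. *)
Definition angle_factor L Q m t : R[i] :=
  if m == 0%N then expi ((ell L 1 - ell Q 1)%:~R * t)
  else (legendre_fun m.+1 (ell L m.+1) (ell L m) t *
        legendre_fun m.+1 (ell Q m.+1) (ell Q m) t * sin t ^+ m)%:C.

Definition angle_length m : R := if m == 0%N then 2 * pi else pi.

Definition factor_ip L Q m : R[i] := cint (angle_length m) (angle_factor L Q m).

Lemma ccontinuous_angle_factor L Q m : ccontinuous (angle_factor L Q m).
Proof.
rewrite /angle_factor; case: m => [|m]; split => /=.
- move=> t /=; rewrite /expi /=.
  apply: (@continuous_comp _ _ _ (fun t => (ell L 1 - ell Q 1)%:~R * t) cos).
    by apply: cvgM; [exact: cvg_cst|exact: cvg_id].
  exact: continuous_cos.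
- move=> t /=; rewrite /expi /=.
  apply: (@continuous_comp _ _ _ (fun t => (ell L 1 - ell Q 1)%:~R * t) sin).
    by apply: cvgM; [exact: cvg_cst|exact: cvg_id].
  exact: continuous_sin.
- have h := @continuous_legendre_ip R m.+2 (ell L m.+2) (ell L m.+1) (ell Q m.+2) (ell Q m.+1).
  by rewrite subn1 in h.
- by move=> t; exact: cvg_cst.
Qed.

(** One bound for all angles: |cos| + |sin| <= 2 over a length 2 pi gives 4 pi for theta_1, and the
    Legendre factors contribute at most the two [kappa] values. *)
Lemma angle_factor_bound L Q m : (m < d.-1)%N ->
  \int[mu]_(t in `]0, angle_length m[) nrm1 (angle_factor L Q m t) <=
  4 * pi + (kappa R 0 + kappa R 1).
Proof.
have p0 := pi_gt0 R; have k0 := kappa_gt0 R 0; have k1 := kappa_gt0 R 1.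
case: m => [|m] hm.
  apply: (@le_trans _ _ (\int[mu]_(t in `]0, 2 * pi[) 2)).
    apply: le_Rintegral => //.
    - apply: continuous_integrable_oo; apply: continuous_nrm1.
      exact: ccontinuous_angle_factor.
    - by apply: continuous_integrable_oo => t; exact: cvg_cst.
    - move=> t _; rewrite /nrm1 /angle_factor /=.
      set s := _ * t; have := cos_max s; have := sin_max s; lra.
  by rewrite Rintegral_oo_cst ?mulr_gt0 //; lra.
have hj : (2 <= m.+2 < d)%N by case: d hm => [|[]].
have [_ hL] := Iset_path L hj; have [_ hQ] := Iset_path Q hj.
have := legendre_ip_bound R hL hQ.
rewrite /angle_length /angle_factor /= subn1 /nrm1 /= => h.
apply: (@le_trans _ _ (kappa R 0 + kappa R 1)); last by lra.
apply: le_trans h; rewrite le_eqVlt; apply/orP; left; apply/eqP.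
by apply: eq_Rintegral => t _; rewrite normr0 addr0.
Qed.

Lemma factor_ip_legendre L Q m : factor_ip L Q m.+1 =
  (legendre_ip R m.+2 (ell L m.+2) (ell L m.+1) (ell Q m.+2) (ell Q m.+1))%:C.
Proof.
rewrite /factor_ip /cint /angle_factor /= /legendre_ip subn1; congr (_ +i* _).
by rewrite Rintegral_cst // mul0r.
Qed.

Lemma factor_ip0 L Q : ell L 1 != ell Q 1 -> factor_ip L Q 0 = 0.
Proof.
move=> h; rewrite /factor_ip /cint /angle_factor /angle_length /=.
set n := (ell L 1 - ell Q 1); have n0 : n != 0 by rewrite subr_eq0.
have nR : n%:~R != 0 :> R by rewrite intr_eq0.
have tp : 0 < 2 * pi :> R by rewrite mulr_gt0 // pi_gt0.
have [c1 c2] := ccontinuous_angle_factor L Q 0.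
have e2 : expi (n%:~R * (2 * pi)) = 1 :> R[i].
  have -> : (n%:~R * (2 * pi)) = (n * 2)%:~R * pi :> R by rewrite intrM; ring.
  have e1 : expi (2%:R * pi) = 1 :> R[i].
    by rewrite mulr_natl /expi cos2pi sin2pi.
  rewrite intrM -mulrA.
  rewrite (@eq_expi_int R n (2%:~R * pi) 0) ?mulr0 ?expi0 //.
    by rewrite -[2%:~R]/(2%:R) mulr_natl cos2pi cos0.
  by rewrite -[2%:~R]/(2%:R) mulr_natl sin2pi sin0.
have [ec es] : cos (n%:~R * (2 * pi)) = 1 :> R /\ sin (n%:~R * (2 * pi)) = 0 :> R.
  by move: e2; rewrite /expi => -[-> ->].
apply/eqP; rewrite eq_complex /=; apply/andP; split; apply/eqP.
- have dF t : is_derive t (1 : R) (fun t => sin (n%:~R * t) / n%:~R) (cos (n%:~R * t)).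
    have d1 : is_derive t (1 : R) (fun t => n%:~R * t) (n%:~R : R).
      by apply: is_derive_eq; rewrite /GRing.scale /=; ring.
    have d2' := is_derive1_comp (is_derive_sin (n%:~R * t)) d1.
    have d3 : is_derive t (1 : R) (cst (n%:~R^-1 : R)) (0 : R) by exact: is_derive_cst.
    have -> : (fun t => sin (n%:~R * t) / n%:~R) =
       (sin \o (fun t => n%:~R * t)) * cst (n%:~R^-1 : R) :> (R -> R) by [].
    apply: (is_derive_eq (is_deriveM d2' d3)).
    by rewrite /GRing.scale /=; field.
  rewrite (Rintegral_oo_FTC tp c1 dF) es mulr0 sin0; ring.
- have dF t : is_derive t (1 : R) (fun t => - cos (n%:~R * t) / n%:~R) (sin (n%:~R * t)).
    have d1 : is_derive t (1 : R) (fun t => n%:~R * t) (n%:~R : R).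
      by apply: is_derive_eq; rewrite /GRing.scale /=; ring.
    have d2' := is_derive1_comp (is_derive_cos (n%:~R * t)) d1.
    have d3 : is_derive t (1 : R) (cst (- n%:~R^-1 : R)) (0 : R) by exact: is_derive_cst.
    have -> : (fun t => - cos (n%:~R * t) / n%:~R) =
       (cos \o (fun t => n%:~R * t)) * cst (- n%:~R^-1 : R) :> (R -> R).
      by apply/funext => s /=; rewrite mulrN mulNr.
    apply: (is_derive_eq (is_deriveM d2' d3)).
    by rewrite /GRing.scale /=; field.
  rewrite (Rintegral_oo_FTC tp c2 dF) ec mulr0 cos0; ring.
Qed.

Lemma factor_ip_diag L m : (m < d.-1)%N -> factor_ip L L m != 0.
Proof.
case: m => [|m] hm.
  rewrite /factor_ip /cint /angle_factor /angle_length /= subrr.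
  rewrite eq_complex negb_and; apply/orP; left => /=.
  under eq_Rintegral do rewrite mul0r cos0.
  have p0 : 0 < 2 * pi :> R by rewrite mulr_gt0 ?pi_gt0.
  by rewrite Rintegral_oo_cst // subr0 mul1r gt_eqF.
have hj : (2 <= m.+2 < d)%N by case: d hm => [|[]].
have [_ hL] := Iset_path L hj.
rewrite factor_ip_legendre legendre_norm // eq_complex negb_and.
by rewrite /= gt_eqF // kappa_gt0.
Qed.

(* At the first index where L and Q differ, the factors are orthogonal. *)
Lemma prod_factor_ip L Q : L != Q -> \prod_(m < d.-1) factor_ip L Q m = 0.
Proof.
move=> LQ.
have [m hm] : exists m, (m < d.-1)%N && (ell L m.+1 != ell Q m.+1).
  apply: contrapT => h; move/negP: LQ; apply; apply/eqP/val_inj/eq_from_tnth => i.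
  rewrite !(tnth_nth 0); apply: contrapT => /eqP hi; apply: h.
  by exists i; rewrite ltn_ord.
case: (ex_minnP (ex_intro (fun m => (m < d.-1)%N && (ell L m.+1 != ell Q m.+1)) m hm)).
move=> {hm} {}m /andP[hm hne] hmin.
suff e : factor_ip L Q m = 0.
  by rewrite (bigD1 (Ordinal hm)) //= e mul0r.
case: m hm hne hmin => [|m] hm hne hmin; first exact: factor_ip0.
have el : ell L m.+1 = ell Q m.+1.
  apply/eqP; apply: contraT => h.
  by have := hmin m; rewrite (ltnW hm) h ltnn => /(_ isT).
have hj : (2 <= m.+2 < d)%N by case: d hm => [|[]].
have [_ hL] := Iset_path L hj; have [_ hQ] := Iset_path Q hj.
rewrite factor_ip_legendre el legendre_orthogonal //.
by rewrite -el.
Qed.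

Lemma conjc_expi (s : R) : ((expi s)^*)%C = expi (- s).
Proof. by rewrite /expi cosN sinN. Qed.

Lemma conjc_real (r : R) : ((r%:C)^*)%C = r%:C.
Proof. by apply/eqP; rewrite eq_complex /= oppr0 !eqxx. Qed.

Lemma real_complexM (x y : R) : (x * y)%:C = x%:C * y%:C.
Proof. by apply/eqP; rewrite eq_complex /= !mulr0 mul0r subr0 addr0 !eqxx. Qed.

Lemma angle_factorC L Q m t : angle_factor Q L m t = ((angle_factor L Q m t)^*)%C.
Proof.
rewrite /angle_factor; case: eqP => _.
  by rewrite conjc_expi -mulNr -mulrNz opprB.
rewrite conjc_real [in LHS](mulrC (legendre_fun _ _ _ t)).
reflexivity.
Qed.

(** On the domain of the angles this is 2 pi times conj Y_Q times the density of the surface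
    measure; 2 pi cancels the constants 1/sqrt(2 pi) of the two harmonics. *)
Definition test_fun Q (s : nat -> R) : R[i] :=
  (Num.sqrt (2 * pi))%:C * expi (- ((ell Q 1)%:~R * s 1)) *
  \prod_(2 <= j < d) (legendre_fun j (ell Q j) (ell Q j.-1) (s j) * sin (s j) ^+ j.-1)%:C.

Lemma prod_angle_factor L Q (s : nat -> R) :
  (forall j, (2 <= j < d)%N -> 0 < s j < pi) ->
  \prod_(m < d.-1) angle_factor L Q m (s m.+1) =
  sph_harmonic L (polar (angle_tuple d s)) * test_fun Q s.
Proof.
move=> hs.
have he j : (0 < j < d)%N -> entry (angle_tuple d s) j = s j by exact: entry_angle_tuple.
rewrite sph_harmonic_polar_angles //; last first.
  by move=> j hj; rewrite he ?hs //; case/andP: hj => [/ltnW -> ->].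
rewrite /sph_harmonic_polar /test_fun he; last by rewrite /= d2.
have -> : \prod_(2 <= j < d) (legendre_tilde j (ell L j) (ell L j.-1)
      (entry (angle_tuple d s) j))%:C =
    \prod_(2 <= j < d) (legendre_fun j (ell L j) (ell L j.-1) (s j))%:C :> R[i].
  apply: eq_big_nat => j hj; have [_ hL] := Iset_path L hj.
  rewrite he; last by case/andP: hj => [/ltnW -> ->].
  by rewrite legendre_tildeE //; have /andP[a b] := hs j hj; rewrite !ltW.
rewrite -(big_mkord xpredT (fun m => angle_factor L Q m (s m.+1))).
rewrite big_ltn; last by case: d d2 => [|[]].
have -> : \prod_(1 <= m < d.-1) angle_factor L Q m (s m.+1) =
  \prod_(2 <= j < d) ((legendre_fun j (ell L j) (ell L j.-1) (s j))%:C *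
    (legendre_fun j (ell Q j) (ell Q j.-1) (s j) * sin (s j) ^+ j.-1)%:C).
  rewrite [RHS]big_add1.
  apply: eq_big_nat => m /andP[m1 _]; rewrite /angle_factor gtn_eqF //=.
  by rewrite -real_complexM mulrA.
rewrite big_split /= /angle_factor /=.
have -> : expi ((ell L 1 - ell Q 1)%:~R * s 1) =
    expi ((ell L 1)%:~R * s 1) * expi (- ((ell Q 1)%:~R * s 1)) :> R[i].
  by rewrite -expiD mulrzBr mulrBl.
have hq : (Num.sqrt (2 * pi))^-1%:C * (Num.sqrt (2 * pi))%:C = 1 :> R[i].
  by rewrite -real_complexM mulVf // gt_eqF // sqrtr_gt0 mulr_gt0 // pi_gt0.
set A := expi _; set B := expi _; set P := \prod_(_ <= _ < _) _; set P' := \prod_(_ <= _ < _) _.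
rewrite -[LHS]mul1r -hq; ring.
Qed.

End TestFunctions.

(** * Uniqueness of the coefficients of a double expansion *)

Section Uniqueness.
Variables (R : realType) (d : nat).
Hypothesis d2 : (2 <= d)%N.
Implicit Types (L Q : Iset d).
Local Notation ell L j := (entry (val L) j).

Lemma csum0_single (u : nat -> R[i]) n0 :
  csum0 u -> (forall n, n != n0 -> u n = 0) -> u n0 = 0.
Proof.
move=> [h1 h2] hu.
have key (P : R[i] -> R) : P 0 = 0 -> series (P \o u) @ \oo --> (0 : R) -> P (u n0) = 0.
  move=> P0 h; apply: (cvg_unique _ _ h) => //.
  apply: cvg_near_cst; exists n0.+1 => // n /= n0n.
  rewrite /series /= big_mkord (bigD1 (Ordinal n0n)) //= big1 ?addr0 // => i.
  by rewrite -val_eqE /= => /hu ->.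
by apply/eqP; rewrite eq_complex /= (key (@complex.Re R)) // (key (@complex.Im R)) // eqxx.
Qed.

Lemma conjcM (x y : R[i]) : ((x * y)^*)%C = ((x^*) * (y^*))%C.
Proof. exact: rmorphM. Qed.

(** The vanishing series is multiplied by test functions for Q and Q' and integrated over 2(d-1)
    angles, those of xi numbered below D and those of zeta from D on. Orthogonality leaves the term
    of (Q, Q'), with a nonzero factor. *)
Lemma harmonic_coef_eq0 (b : Iset d * Iset d -> R[i]) :
  abs_summable (enumerate b) ->
  (forall xi zeta : 'rV[R]_d, unit_sphere xi -> unit_sphere zeta ->
     csum0 (enumerate (fun p => b p * sph_harmonic p.1 xi *
                                (sph_harmonic p.2 zeta)^*))) ->
  forall q, b q = 0.
Proof.
move=> sb hb [Q Q'].
(* For n not a code the default pair is harmless: [enumerate b n] is 0 there, and the factors of the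
   default obey the same bounds. *)
pose D := d.-1; pose pr n := odflt (Q, Q') (@pickle_inv (Iset d * Iset d)%type n).
pose G m n : R -> R[i] := if (m < D)%N then angle_factor (pr n).1 Q m
                          else angle_factor Q' (pr n).2 (m - D).
pose T m : R := angle_length R (if (m < D)%N then m else (m - D)%N).
have cG m n : ccontinuous (G m n).
  by rewrite /G; case: ifP => _; exact: ccontinuous_angle_factor.
have hB m n : (m < D + D)%N ->
    \int[@lebesgue_measure R]_(t in `]0, T m[) nrm1 (G m n t) <=
    4 * pi + (kappa R 0 + kappa R 1).
  move=> mDD; rewrite /G /T; case: (ltnP m D) => hmD; apply: angle_factor_bound => //.
  by rewrite ltn_subLR.
have split_prod (F : nat -> R[i]) : \prod_(m < D + D) F m =
    (\prod_(m < D) F m) * \prod_(m < D) F (D + m)%N.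
  by rewrite big_split_ord.
have Gl m n : (m < D)%N -> G m n = angle_factor (pr n).1 Q m by rewrite /G => ->.
have Gr m n : G (D + m)%N n = angle_factor Q' (pr n).2 m.
  by rewrite /G ltnNge leq_addr /= addKn.
have := @csum0_integral R T G (fun=> 4 * pi + (kappa R 0 + kappa R 1)) (D + D)
  (enumerate b) cG hB sb.
have hz (t : nat -> R) : (forall m, (m < D + D)%N -> 0 < t m < T m) ->
    csum0 (fun n => enumerate b n * \prod_(m < D + D) G m n (t m)).
  move=> ht; pose s j := t j.-1; pose s' j := t (D + j.-1)%N.
  have hs j : (2 <= j < d)%N -> 0 < s j < pi.
    case: j => [|[|j]] // /andP[_ jd].
    have jD : (j.+1 < D)%N by rewrite /D; case: d jd => [|[]].
    by have := ht j.+1 (leq_trans jD (leq_addr _ _)); rewrite /T jD.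
  have hs' j : (2 <= j < d)%N -> 0 < s' j < pi.
    case: j => [|[|j]] // /andP[_ jd].
    have jD : (j.+1 < D)%N by rewrite /D; case: d jd => [|[]].
    have := ht (D + j.+1)%N; rewrite ltn_add2l jD => /(_ isT).
    by rewrite /T ltnNge leq_addr /= addKn.
  (* At fixed angles the test functions do not depend on n and come out as a constant. For zeta the
     factors are the conjugates of those in [prod_angle_factor]. *)
  have -> : (fun n => enumerate b n * \prod_(m < D + D) G m n (t m)) =
      (fun n => test_fun Q s * (test_fun Q' s')^* * enumerate (fun p => b p *
        sph_harmonic p.1 (polar (angle_tuple d s)) *
        (sph_harmonic p.2 (polar (angle_tuple d s')))^*) n).
    apply/funext => n; rewrite (split_prod (fun m => G m n (t m))).
    rewrite (eq_bigr (fun m : 'I_D => angle_factor (pr n).1 Q m (s m.+1))); last first.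
      by move=> m _; rewrite Gl.
    rewrite [X in _ * (_ * X)](eq_bigr (fun m : 'I_D =>
        (angle_factor (pr n).2 Q' m (s' m.+1))^*)); last first.
      by move=> m _; rewrite Gr angle_factorC.
    rewrite -(big_morph (fun x : R[i] => x^*) conjcM (conjc1 R)).
    rewrite !prod_angle_factor // conjcM /enumerate /pr.
    by case: pickle_inv => [p|] /=; [ring | rewrite mul0r mulr0].
  by apply: csum0Z; apply: hb; exact: polar_unit_sphere.
move=> /(_ hz) hc.
have [P [P' [P0 P0' P1 P1' ip]]] : exists P P' : Iset d -> R[i],
    [/\ forall L, L != Q -> P L = 0, forall L, Q' != L -> P' L = 0,
        P Q != 0, P' Q' != 0 &
        forall n, \prod_(m < D + D) cint (T m) (G m n) = P (pr n).1 * P' (pr n).2].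
  exists (fun L => \prod_(m < D) factor_ip R L Q m).
  exists (fun L => \prod_(m < D) factor_ip R Q' L m); split.
  - by move=> L h; rewrite (prod_factor_ip R h).
  - by move=> L h; rewrite (prod_factor_ip R h).
  - by apply/prodf_neq0 => m _; exact: factor_ip_diag.
  - by apply/prodf_neq0 => m _; exact: factor_ip_diag.
  - move=> n; rewrite (split_prod (fun m => cint (T m) (G m n))).
    congr (_ * _); apply: eq_bigr => m _; first by rewrite Gl // /T ltn_ord.
    by rewrite Gr /T ltnNge leq_addr /= addKn.
have {}hc : csum0 (fun n => enumerate b n * (P (pr n).1 * P' (pr n).2)).
  by move: hc; congr csum0; apply/funext => n; rewrite ip.
have hne n : n != choice.pickle (Q, Q') ->
    enumerate b n * (P (pr n).1 * P' (pr n).2) = 0.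
  move=> hn; rewrite /enumerate /pr.
  case e : (pickle_inv n) => [[L L']|] /=; last by rewrite mul0r.
  have [eL|nL] := eqVneq L Q; last by rewrite (P0 _ nL) mul0r mulr0.
  have [eL'|nL'] := eqVneq Q' L'; last by rewrite (P0' _ nL') !mulr0.
  have := @pickle_invK (Iset d * Iset d)%type n; rewrite e /= eL -eL' => en.
  by rewrite en eqxx in hn.
have /eqP := csum0_single hc hne.
by rewrite /enumerate /pr pickleK_inv /= !mulf_eq0 (negbTE P1) (negbTE P1') !orbF => /eqP.
Qed.

End Uniqueness.

(** * Expansion of the rotated kernel and its consequences for the coefficients *)

Section RotatedKernels.
Variables (R : realType) (d : nat).
Hypothesis d2 : (2 <= d)%N.
Implicit Types (a : Iset d -> Iset d -> R[i]) (xi zeta : 'rV[R]_d).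
Local Notation ell L j := (entry (val L) j).

Lemma unit_sphere_rotation xi alpha : unit_sphere xi ->
  unit_sphere (xi *m rotation d alpha).
Proof.
move=> hx; have [_ <-] := polar_angles d2 hx; set th := angles xi.
rewrite -(@polar_rotation _ _ th (angle_tuple d
  (fun j => if j == 1%N then entry th 1 + alpha else entry th j))) //.
- exact: polar_unit_sphere.
- by rewrite entry_angle_tuple.
- by move=> j /andP[j2 jd]; rewrite entry_angle_tuple ?jd ?(ltnW j2) // gtn_eqF.
Qed.

Lemma conj_expi (t : R) : Num.conj (expi t) = expi (- t).
Proof. exact: conjc_expi. Qed.

Lemma rotated_term a xi zeta alpha (p : Iset d * Iset d) :
  unit_sphere xi -> unit_sphere zeta ->
  a p.1 p.2 * sph_harmonic p.1 (xi *m rotation d alpha) *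
    (sph_harmonic p.2 (zeta *m rotation d alpha))^* =
  a p.1 p.2 * expi ((ell p.1 1 - ell p.2 1)%:~R * alpha) *
    sph_harmonic p.1 xi * (sph_harmonic p.2 zeta)^*.
Proof.
move=> hx hz; rewrite !sph_harmonic_rotation // rmorphM /= conj_expi.
rewrite mulrzBr mulrBl expiD; ring.
Qed.

Lemma nrm1_expi_sub1 (t : R) : nrm1 (expi t - 1) <= 3.
Proof.
rewrite /nrm1 /expi /= subr0.
have h1 := cos_max t; have h2 := sin_max t.
have := ler_normB (cos t) 1; rewrite normr1; lra.
Qed.

(** Each weight is at least 1/sigma, as both dimensions are at least 1. The constant is 6 sigma,
    with 2 from [nrm1_le_cmod] and 3 from the bound on c. *)
Lemma abs_summable_coef a (c : Iset d * Iset d -> R[i]) :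
  (\esum_(p in [set: Iset d * Iset d])
     (cmod (a p.1 p.2) *
      (Num.sqrt (dim_harmonics R d (deg p.1) * dim_harmonics R d (deg p.2)) /
       sphere_area R d))%:E < +oo)%E ->
  (forall p, nrm1 (c p) <= 3) ->
  abs_summable (enumerate (fun p => a p.1 p.2 * c p)).
Proof.
move=> ha hc; have s0 := sphere_area_gt0 R d2.
have w1 p : 1 <= Num.sqrt (dim_harmonics R d (deg p.1) * dim_harmonics R d (deg p.2)) :> R.
  have hp := mulr_ege1 (dim_harmonics_ge1 R d2 (deg p.1)) (dim_harmonics_ge1 R d2 (deg p.2)).
  by rewrite -[leLHS]sqrtr1 ler_sqrt // (le_trans ler01).
apply: (abs_summable_enumerate (C := 6 * sphere_area R d) _ _ _ ha) => [p||p].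
- apply: le_trans (nrm1M _ _) _.
  apply: (@le_trans _ _ ((2 * cmod (a p.1 p.2)) * 3)).
    by apply: ler_pM; rewrite ?nrm1_ge0 ?nrm1_le_cmod ?hc.
  have -> : 6 * sphere_area R d * (cmod (a p.1 p.2) *
     (Num.sqrt (dim_harmonics R d (deg p.1) * dim_harmonics R d (deg p.2)) / sphere_area R d)) =
     2 * cmod (a p.1 p.2) * 3 *
     Num.sqrt (dim_harmonics R d (deg p.1) * dim_harmonics R d (deg p.2)).
    by field; rewrite gt_eqF.
  by rewrite ler_peMr ?w1 // !mulr_ge0 // cmod_ge0.
- by rewrite mulr_ge0 // ltW.
- by rewrite mulr_ge0 ?cmod_ge0 // divr_ge0 ?sqrtr_ge0 // ltW.
Qed.

(** By symmetry the expansions at the rotated and at the original points have the same sum. Their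
    difference is an expansion of 0 with coefficients a (exp(i (l_1 - l_1') alpha) - 1), which
    vanish by uniqueness. *)
Lemma axially_symmetric_coef_eq0 (K : 'rV[R]_d -> 'rV[R]_d -> R[i]) a :
  (\esum_(p in [set: Iset d * Iset d])
     (cmod (a p.1 p.2) *
      (Num.sqrt (dim_harmonics R d (deg p.1) * dim_harmonics R d (deg p.2)) /
       sphere_area R d))%:E < +oo)%E ->
  (forall xi zeta, unit_sphere xi -> unit_sphere zeta ->
     has_sum (fun p : Iset d * Iset d =>
       a p.1 p.2 * sph_harmonic p.1 xi * (sph_harmonic p.2 zeta)^*) (K xi zeta)) ->
  axially_symmetric K ->
  forall L L' : Iset d, ell L 1 != ell L' 1 -> a L L' = 0.
Proof.
move=> ha hK hax L L' hl.
pose n := ell L 1 - ell L' 1.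
have nR : n%:~R != 0 :> R by rewrite intr_eq0 subr_eq0.
(* This angle turns the factor at the pair (L, L') into exp(i pi) - 1 = -2, which is not 0. *)
pose alpha : R := pi / n%:~R.
pose c (p : Iset d * Iset d) : R[i] := expi ((ell p.1 1 - ell p.2 1)%:~R * alpha) - 1.
have sb := abs_summable_coef ha (fun p => nrm1_expi_sub1 _ : nrm1 (c p) <= 3).
have hb xi zeta : unit_sphere xi -> unit_sphere zeta ->
    csum0 (enumerate (fun p => a p.1 p.2 * c p * sph_harmonic p.1 xi *
                               (sph_harmonic p.2 zeta)^*)).
  move=> hx hz.
  have h1 := hK _ _ (unit_sphere_rotation alpha hx) (unit_sphere_rotation alpha hz).
  rewrite (hax _ _ alpha hx hz) in h1.
  have := csum0_has_sum_sub h1 (hK _ _ hx hz).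
  congr (csum0 (enumerate _)); apply/funext => p.
  by rewrite rotated_term // /c; ring.
have en : n%:~R * alpha = pi by rewrite /alpha mulrC divfK.
have /eqP := harmonic_coef_eq0 d2 sb hb (L, L').
rewrite /c /= -/n en mulf_eq0 => /orP[/eqP //|].
by move=> /eqP/(congr1 (@complex.Re R)); rewrite /expi cospi /= => h; exfalso; clear -h; lra.
Qed.

End RotatedKernels.

Unset Implicit Arguments.
Set Strict Implicit.

Theorem theorem1 (R : realType) (d : nat) (hd : (2 <= d)%N)
    (K : 'rV[R]_d -> 'rV[R]_d -> R[i])
    (a : Iset d -> Iset d -> R[i])
    (ha : (\esum_(p in [set: Iset d * Iset d])
             (cmod (a p.1 p.2) *
              (Num.sqrt (dim_harmonics R d (deg p.1) *
                         dim_harmonics R d (deg p.2)) /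
               sphere_area R d))%:E < +oo)%E)
    (hK : forall xi zeta : 'rV[R]_d,
        unit_sphere xi -> unit_sphere zeta ->
        has_sum (fun p : Iset d * Iset d =>
                   a p.1 p.2 * sph_harmonic p.1 xi * (sph_harmonic p.2 zeta)^*)
                (K xi zeta)) :
  axially_symmetric K <->
  exists c : int -> (d.-2).-tuple int -> (d.-2).-tuple int -> R[i],
    forall L L' : Iset d,
      a L L' = (entry (val L) 1 == entry (val L') 1)%:R *
               c (entry (val L) 1) [tuple of behead (val L)]
                                   [tuple of behead (val L')].
Proof.
split=> [hax|[c hc]]; last first.
  (* The rotated and the original family agree term by term: either l_1 = l_1' and the phase is 1,
     or the coefficient is 0. *)
  move=> xi zeta alpha hx hz; apply: (has_sum_unique _ (hK _ _ hx hz)).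
  have := hK _ _ (unit_sphere_rotation hd alpha hx) (unit_sphere_rotation hd alpha hz).
  congr (has_sum _ _); apply/funext => p; rewrite (rotated_term hd) // hc.
  case: eqVneq => [->|_]; last by rewrite !mul0r.
  by rewrite subrr mul0r expi0 mulr1.
have a0 := axially_symmetric_coef_eq0 hd ha hK hax.
case: d hd a {K ha hK hax} a0 => [|[|e]] // _ a a0.
(* [I] reassembles a multi-index from l_1 and the other entries, and [c] is set to 0 where the
   result is not in the index set. As l_1 = l_1' in the remaining case, one l serves both
   indices. *)
pose I (l : int) (t : e.-tuple int) : option (Iset e.+2) := insub (cons_tuple l t).
exists (fun l t t' =>
  if I l t is Some L then if I l t' is Some L' then a L L' else 0 else 0) => L L'.
have [l1|l1] := eqVneq (entry (val L) 1) (entry (val L') 1); last first.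
  by rewrite mul0r a0.
have IE (M : Iset e.+2) : I (entry (val M) 1) [tuple of behead (val M)] = Some M.
  rewrite /I (_ : cons_tuple _ _ = val M) ?valK //.
  by case: M => [[[|x s] hs] hM]; apply: val_inj.
by rewrite mul1r IE l1 IE.
Qed.
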